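(* Let $n\ge 2$ and let $u=u(r)$ be a function such that $x\mapsto u(|x|)$ is smooth on $\mathbb{R}^n$ and, for $r>0$, $$\begin{cases}u''+\dfrac{u'}{r}+e^{2u}\le 0,\\[4pt] u''+(2n-3)\dfrac{u'}{r}+(n-2)(u')^2+(n-1)e^{2u}\le 0.\end{cases}$$ Let $g=e^{2u(|\cdot|)}\delta$, where $\delta$ is the Euclidean metric in $\mathbb{R}^n$. Then $$\mathrm{diam}_g(\mathbb{R}^n)\le\pi\qquad\text{and}\qquad \mathrm{vol}_g(\mathbb{R}^n)\le\mathrm{vol}(S^n).$$
   Context: Primes denote derivatives with respect to $r$. The two differential inequalities together are equivalent to $\mathrm{Ric}_g\ge(n-1)g$. $d_g(x,y)$ is the infimum of the $g$-lengths of piecewise smooth curves from $x$ to $y$, $\mathrm{diam}_g(\mathbb{R}^n)=\sup_{x,y} d_g(x,y)$, $\mathrm{vol}_g(\mathbb{R}^n)=\int_{\mathbb{R}^n}e^{n u(|x|)}\,dx$ is the Riemannian volume, and $\mathrm{vol}(S^n)$ is the $n$-dimensional volume of the unit round sphere $S^n$. *)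

(* Defs.v *)
From HB Require Import structures.
From mathcomp Require Import all_boot all_order all_algebra.
From mathcomp Require Import all_classical all_reals all_analysis.
From mathcomp Require Import ring lra.

Set Implicit Arguments.
Unset Strict Implicit.
Unset Printing Implicit Defensive.

Import Order.TTheory GRing.Theory Num.Theory.
Import numFieldNormedType.Exports.

Local Open Scope classical_set_scope.
Local Open Scope ring_scope.

(* The norm `|x| of the library on 'rV[R]_n is the sup norm. *)
Definition enorm (R : realType) (n : nat) (x : 'rV[R]_n) : R :=
  Num.sqrt (\sum_(i < n) x 0 i ^+ 2).

(* For finite-dimensional V, having continuous derivatives of order at most k
   along all directions is the same as being of class C^k. *)
Fixpoint class_C (R : realType) (V W : normedModType R) (k : nat)
    (f : V -> W) : Prop :=
  match k with
  | 0 => continuous f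
  | k'.+1 => continuous f /\
      forall v : V, (forall x, derivable f x v) /\ class_C k' ('D_v f)
  end.

Definition smooth (R : realType) (V W : normedModType R) (f : V -> W) : Prop :=
  forall k, class_C k f.

(* Smoothness of a piece on a closed interval means that it is the restriction
   of a smooth map on R.  Consecutive closed pieces share an endpoint, so the
   curve is continuous on [a, b]. *)
Definition piecewise_smooth (R : realType) (n : nat) (a b : R)
    (gamma : R -> 'rV[R]_n) : Prop :=
  exists s : seq R, itv_partition a b s /\
    forall i, (i < size s)%N ->
      exists2 delta : R -> 'rV[R]_n, smooth delta &
        {in `[nth a (a :: s) i, nth a s i]%R, gamma =1 delta}.

Section conformal_metric.
Variables (R : realType) (n : nat).
(* The metric is e^{2 w} times the Euclidean one. *)
Variable w : 'rV[R]_n -> R.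
Local Open Scope ereal_scope.

(* The value of derive1 gamma at the finitely many break points is irrelevant. *)
Definition conf_length (a b : R) (gamma : R -> 'rV[R]_n) : \bar R :=
  \int[lebesgue_measure]_(t in `[a, b])
    (expR (w (gamma t)) * enorm (derive1 gamma t))%:E.

Definition conf_dist (x y : 'rV[R]_n) : \bar R :=
  ereal_inf [set l | exists a b (gamma : R -> 'rV[R]_n),
    [/\ (a <= b)%R, piecewise_smooth a b gamma, gamma a = x, gamma b = y &
        l = conf_length a b gamma]].

Definition conf_diam : \bar R :=
  ereal_sup [set d | exists x y, d = conf_dist x y].

End conformal_metric.

Section lebesgue_tuple.
Variable R : realType.
Local Notation mR := (measurableTypeR R).

Definition cons_tuple_pair (n : nat) (p : mR * n.-tuple mR) : n.+1.-tuple mR :=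
  [tuple of p.1 :: p.2].

Lemma measurable_cons_tuple_pair n : measurable_fun setT (@cons_tuple_pair n).
Proof. exact: measurable_cons. Qed.

Section step.
Variables (n : nat) (m : {sigma_finite_measure set (n.-tuple mR) -> \bar R}).
Local Open Scope ereal_scope.

Definition lebesgue_tuple_step : set (n.+1.-tuple mR) -> \bar R :=
  pushforward (@lebesgue_measure R \x m) (@cons_tuple_pair n).

Let step0 : lebesgue_tuple_step set0 = 0.
Proof. by rewrite /lebesgue_tuple_step /pushforward preimage_set0 measure0. Qed.

Let step_ge0 A : 0 <= lebesgue_tuple_step A.
Proof. by rewrite /lebesgue_tuple_step /pushforward measure_ge0. Qed.

Let step_sigma_additive : semi_sigma_additive lebesgue_tuple_step.
Proof.
move=> F mF tF mUF; rewrite /lebesgue_tuple_step /pushforward preimage_bigcup.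
have mE i : measurable (@cons_tuple_pair n @^-1` F i).
  by rewrite -[X in measurable X]setTI; exact: measurable_cons_tuple_pair.
apply: measure_semi_sigma_additive => //; last exact: bigcup_measurable.
apply/trivIsetP => /= i j _ _ ij; rewrite -preimage_setI.
by move/trivIsetP : tF => /(_ _ _ _ _ ij) ->//; rewrite preimage_set0.
Qed.

HB.instance Definition _ := isMeasure.Build _ _ _
  lebesgue_tuple_step step0 step_ge0 step_sigma_additive.

Let step_sigma_finite : sigma_finite setT lebesgue_tuple_step.
Proof.
have /sigma_finiteP[F [TF ndF Foo]] := sigma_finiteT (@lebesgue_measure R).
have /sigma_finiteP[G [TG ndG Goo]] := sigma_finiteT m.
pose uncons (t : n.+1.-tuple mR) := (thead t, [tuple of behead t]).
have muncons : measurable_fun setT uncons.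
  apply/measurable_fun_pair; last exact: measurable_behead.
  exact: measurable_tnth.
exists (fun k => uncons @^-1` (F k `*` G k)).
  rewrite -preimage_bigcup; apply/esym/seteqP; split=> // t _.
  have [k _ Fk] : (\bigcup_k F k) (uncons t).1 by rewrite -TF.
  have [l _ Gl] : (\bigcup_k G k) (uncons t).2 by rewrite -TG.
  exists (maxn k l) => //; split.
    by move: Fk; exact/subsetPset/ndF/leq_maxl.
  by move: Gl; exact/subsetPset/ndG/leq_maxr.
move=> k; have [mF Fk] := Foo k; have [mG Gk] := Goo k; split.
  by rewrite -[X in measurable X]setTI; apply: muncons => //; exact: measurableX.
rewrite /lebesgue_tuple_step /pushforward -comp_preimage.
suff -> : uncons \o @cons_tuple_pair n = id.
  by rewrite preimage_id product_measure1E// lte_mul_pinfty// ge0_fin_numE.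
by apply/funext => -[x t] /=; congr pair; exact: val_inj.
Qed.

HB.instance Definition _ := Measure_isSigmaFinite.Build _ _ _
  lebesgue_tuple_step step_sigma_finite.

End step.

Fixpoint lebesgue_tuple (n : nat) :
    {sigma_finite_measure set (n.-tuple mR) -> \bar R} :=
  match n with
  | 0 => \d_([tuple] : 0.-tuple mR)
  | n'.+1 => lebesgue_tuple_step (lebesgue_tuple n')
  end.

End lebesgue_tuple.

Definition integral_Rn (R : realType) (n : nat) (f : 'rV[R]_n -> \bar R)
    : \bar R :=
  \int[lebesgue_tuple R n]_t f (\row_(i < n) tnth t i).

Definition conf_volume (R : realType) (n : nat) (w : 'rV[R]_n -> R) : \bar R :=
  integral_Rn (fun x => (expR (n%:R * w x))%:E).

(* n-dimensional volume of the image of an injective immersion phi, i.e. the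
   volume of R^n for the pull-back by phi of the Euclidean metric; jacobian acts
   on row vectors, so the Gram matrix of the partial derivatives is J J^T. *)
Definition parametrized_volume (R : realType) (n m : nat)
    (phi : 'rV[R]_n -> 'rV[R]_m) : \bar R :=
  integral_Rn (fun x =>
    (Num.sqrt (\det (jacobian phi x *m (jacobian phi x)^T)))%:E).

Definition sphere (R : realType) (n : nat) : set 'rV[R]_(n + 1) :=
  [set y | enorm y = 1].

Definition north_pole (R : realType) (n : nat) : 'rV[R]_(n + 1) :=
  row_mx 0 1%:M.

Definition inv_stereo (R : realType) (n : nat) (x : 'rV[R]_n) : 'rV[R]_(n + 1) :=
  row_mx ((2 / (1 + enorm x ^+ 2)) *: x)
         (((enorm x ^+ 2 - 1) / (1 + enorm x ^+ 2))%:M).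

Lemma sqr_enorm (R : realType) (n : nat) (x : 'rV[R]_n) :
  enorm x ^+ 2 = \sum_(i < n) x 0 i ^+ 2.
Proof. by rewrite sqr_sqrtr// sumr_ge0// => i _; exact: sqr_ge0. Qed.

Lemma sqr_enormZ (R : realType) (n : nat) (a : R) (x : 'rV[R]_n) :
  enorm (a *: x) ^+ 2 = a ^+ 2 * enorm x ^+ 2.
Proof.
by rewrite !sqr_enorm mulr_sumr; apply: eq_bigr => i _; rewrite mxE exprMn.
Qed.

Lemma sqr_enorm_row_mx (R : realType) (n : nat) (x : 'rV[R]_n) (a : R) :
  enorm (row_mx x a%:M) ^+ 2 = enorm x ^+ 2 + a ^+ 2.
Proof.
rewrite !sqr_enorm big_split_ord/= big_ord1 row_mxEr mxE eqxx mulr1n.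
by congr (_ + _); apply: eq_bigr => i _; rewrite row_mxEl.
Qed.

Lemma sphereE (R : realType) (n : nat) (y : 'rV[R]_(n + 1)) :
  @sphere R n y <-> enorm y ^+ 2 = 1.
Proof.
split=> [->|/eqP]; first by rewrite expr1n.
by rewrite sqrp_eq1 ?sqrtr_ge0// => /eqP.
Qed.

(* The parametrization misses a single point, which has volume zero, so that it
   computes the full volume of the sphere. *)
Lemma inv_stereo_bij (R : realType) (n : nat) :
  set_bij setT (@sphere R n `\ north_pole R n) (@inv_stereo R n).
Proof.
have pos (x : 'rV[R]_n) : 1 + enorm x ^+ 2 != 0.
  by rewrite gt_eqF// ltr_wpDr ?sqr_ge0.
split.
- move=> x _; split.
    apply/sphereE; rewrite sqr_enorm_row_mx sqr_enormZ.
    by have := pos x => px; field.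
  move=> /eq_row_mx[_ /matrixP/(_ 0 0)]; rewrite !mxE eqxx !mulr1n.
  have px := pos x; move/(congr1 ( *%R^~ (1 + enorm x ^+ 2))).
  by rewrite mulfVK// => ?; lra.
- move=> x y _ _ /eq_row_mx[exy /matrixP/(_ 0 0)]; rewrite !mxE eqxx !mulr1n.
  have px := pos x; have py := pos y => e.
  have nxy : enorm x ^+ 2 = enorm y ^+ 2.
    have : (enorm x ^+ 2 - 1) * (1 + enorm y ^+ 2) =
           (enorm y ^+ 2 - 1) * (1 + enorm x ^+ 2).
      by apply/eqP; rewrite -eqr_div//; exact/eqP.
    by move=> ?; lra.
  by move: exy; rewrite nxy; apply: scalerI; rewrite mulf_neq0// invr_eq0.
- move=> y [/sphereE Sy Ny]; rewrite -[y]hsubmxK in Sy Ny *.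
  move: (lsubmx y) (rsubmx y) Sy Ny => x z; rewrite [z]mx11_scalar.
  move: (z 0 0) => {z} a; rewrite sqr_enorm_row_mx => Sxa Nxa.
  have a1 : 1 - a != 0.
    apply/eqP => a1; have {}a1 : a = 1 by lra.
    subst a.
    apply: Nxa => /=; congr row_mx; apply/rowP => i; rewrite mxE.
    have : \sum_(i < n) x 0 i ^+ 2 == 0 by rewrite -sqr_enorm; apply/eqP; lra.
    rewrite psumr_eq0; last by move=> j _; exact: sqr_ge0.
    by move=> /allP/(_ i); rewrite mem_index_enum sqrf_eq0 => /(_ isT)/eqP.
  exists ((1 - a)^-1 *: x) => //; rewrite /inv_stereo sqr_enormZ scalerA.
  have -> : enorm x ^+ 2 = (1 - a) * (1 + a) by lra.
  have e : 1 + (1 - a)^-1 ^+ 2 * ((1 - a) * (1 + a)) = 2 / (1 - a) by field.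
  rewrite e; congr row_mx.
    by rewrite -[RHS]scale1r; congr (_ *: _); field.
  by congr (_%:M); field.
Qed.

Definition sphere_volume (R : realType) (n : nat) : \bar R :=
  parametrized_volume (@inv_stereo R n).

(* Main.v *)
Require Import Defs.
From mathcomp Require Import all_boot all_order all_algebra.
From mathcomp Require Import all_classical all_reals all_analysis.
From mathcomp Require Import measurable_realfun ring lra.
Import Order.TTheory GRing.Theory Num.Theory.
Import numFieldNormedType.Exports.
Local Open Scope classical_set_scope.
Local Open Scope ring_scope.

(** In geodesic polar coordinates around the origin the metric reads
    [ds^2 + f(s)^2 dtheta^2], where [s(r)] is the integral of [e^u] from [0] to
    [r] and [f = r e^u].  Since [df/ds = 1 + r u'], the first differential
    inequality says exactly that [f'' <= - f] with respect to [s]: the radial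
    curvatures are at least [1].  As [f(0) = 0] and [f'(0) = 1], Sturm comparison
    with the round sphere gives [f <= sin s] ([warp_le_sin]); as [f > 0], it
    follows that [s] stays below [pi] ([geodesic_radius_lt_pi]).

    Diameter.  Because [s' = f / r] and [s] is bounded, [f] cannot stay away from
    [0] ([warp_small]): the circles at infinity are arbitrarily short along a
    sequence of radii, and infinity acts as a second pole.  Two points at radii
    [s1] and [s2] are therefore joined through the origin with length [s1 + s2],
    and through a far away circle with length at most [2 pi - s1 - s2 + epsilon];
    one of the two is at most [pi], up to [epsilon].

    Volume.  The inverse stereographic projection pulls the round metric back to
    [(2 / (1 + |x|^2))^2] times the Euclidean one, so the volume of the sphere is
    the integral over [R^n] of [(2 / (1 + |x|^2))^n] ([sphere_volumeE]).  The
    radial map of profile [rho(r) = tan(s(r) / 2)] keeps the geodesic distance to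
    the pole, and because [f <= sin s] it does not decrease volume
    ([radial_transplant]).  Instead of integrating in polar coordinates, one
    compares the masses of the balls of radii [r] and [rho(r)] by differentiating
    in [r] ([radial_integral_comparison]); this uses only that the Lebesgue
    measure of a ball is proportional to the [n]-th power of its radius
    ([tball_measure]). *)

Set Implicit Arguments.
Unset Strict Implicit.
Unset Printing Implicit Defensive.

(** * Monotonicity and the Euclidean norm *)

(** The sign of the derivative is asked only inside the interval because the
    differential inequality says nothing at the origin. *)
Lemma ge0_is_derive_le (R : realType) (f df : R -> R) (a b : R) : a <= b ->
  (forall x, a <= x <= b -> is_derive x 1 f (df x)) ->
  (forall x, a < x < b -> 0 <= df x) -> f a <= f b.
Proof.
rewrite le_eqVlt => /predU1P[->//|ab] fdf df0.
have cf : {within `[a, b], continuous f}.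
  by apply: derivable_within_continuous => x; rewrite in_itv => /fdf [].
have fdf' x : x \in `]a, b[ -> is_derive x 1 f (df x).
  by rewrite in_itv/= => /andP[/ltW ax /ltW xb]; apply: fdf; rewrite ax.
have [x xab fE] := MVT ab fdf' cf.
by rewrite -subr_ge0 fE mulr_ge0// ?subr_ge0 ?(ltW ab)// df0.
Qed.

Section enorm_facts.
Variables (R : realType) (n : nat).
Implicit Types p q : 'rV[R]_n.

Lemma enorm_ge0 p : 0 <= enorm p.
Proof. exact: sqrtr_ge0. Qed.

Lemma enormZ (c : R) p : enorm (c *: p) = `|c| * enorm p.
Proof.
apply/eqP; rewrite -(@eqrXn2 _ 2)// ?mulr_ge0 ?enorm_ge0//.
by rewrite sqr_enormZ exprMn real_normK// num_real.
Qed.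

Lemma continuous_enorm : continuous (@enorm R n).
Proof.
move=> p; rewrite (_ : @enorm R n =
    @Num.sqrt R \o \sum_(i < n) (fun p : 'rV[R]_n => p 0 i : R) ^+ 2); last first.
  by apply/funext => x; rewrite /enorm/= fct_sumE.
apply: continuous_comp; last exact: sqrt_continuous.
apply: differentiable_continuous; apply: differentiable_sum => i.
by apply: differentiableX; exact: differentiable_coord.
Qed.

End enorm_facts.

(** * Lebesgue measure of balls *)

(** Bundles the pushforward with the measurability of [f], in the form in which
    uniqueness theorems for measures consume it. *)
Lemma image_measure d d' (T1 : measurableType d) (T2 : measurableType d')
    (R : realFieldType) (m : {measure set T1 -> \bar R}) (f : T1 -> T2) :
  measurable_fun setT f ->
  exists nu : {measure set T2 -> \bar R}, forall A, nu A = m (f @^-1` A).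
Proof. by move=> mf; unshelve eexists (pushforward m f). Qed.

Section scaling.
Variable R : realType.
Local Notation mR := (measurableTypeR R).
Local Notation mu n := (lebesgue_tuple R n).

Definition scale_tuple n (c : R) (t : n.-tuple mR) : n.-tuple mR :=
  map_tuple ( *%R c) t.

Lemma measurable_scale (c : R) : measurable_fun [set: mR] ( *%R c : mR -> mR).
Proof. by []. Qed.

Lemma measurable_scale_tuple n (c : R) : measurable_fun setT (@scale_tuple n c).
Proof.
apply/measurable_fun_tnthP => i.
rewrite (_ : _ \o _ = ( *%R c : mR -> mR) \o (@tnth n mR ^~ i)).
  by apply: measurableT_comp; [exact: measurable_scale|exact: measurable_tnth].
by apply/funext => t /=; rewrite tnth_map.
Qed.

Lemma lebesgue_measure_scale (c : R) (A : set mR) : 0 < c -> measurable A ->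
  lebesgue_measure A = (c%:E * lebesgue_measure (( *%R c : mR -> mR) @^-1` A))%E.
Proof.
move=> c0 mA; pose cn := NngNum (ltW c0).
have [nu nuE] := image_measure (@lebesgue_measure R) (@measurable_scale c).
rewrite -nuE -[RHS]/(mscale cn nu A); apply: lebesgue_measure_unique mA => /=.
move=> _ [[a b]] _ <-; rewrite /mscale/= nuE.
rewrite (_ : _ @^-1` _ = `]a / c, b / c]%classic); last first.
  by apply/seteqP; split=> x /=; rewrite !in_itv/= ltr_pdivrMr// ler_pdivlMr// (mulrC x).
rewrite !lebesgue_measure_itv/= (lebesgue_measure_itv `]a / c, b / c])/=.
rewrite !lte_fin ltr_pM2r ?invr_gt0//.
case: ifP => _; last by rewrite mule0.
by rewrite -!EFinB -EFinM mulrBr !(mulrC c) !divfK ?gt_eqF.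
Qed.

(** Both sides are measures in [A], and on a box they agree by induction on the
    dimension, so that uniqueness of the product measure concludes. *)
Lemma lebesgue_tuple_scale n (c : R) (A : set (n.-tuple mR)) : 0 < c ->
  measurable A ->
  mu n A = ((c ^+ n)%:E * mu n (@scale_tuple n c @^-1` A))%E.
Proof.
move=> c0; elim: n A => [|n IH] A mA.
  rewrite expr0 mul1e; congr (_ _).
  apply/seteqP; split => t /=; rewrite (_ : scale_tuple c t = t)//;
  by rewrite [LHS]tuple0 [RHS]tuple0.
pose g (p : mR * n.-tuple mR) : mR * n.-tuple mR := (c * p.1, scale_tuple c p.2).
have mg : measurable_fun setT g.
  apply/measurable_fun_pair.
    by apply: measurableT_comp; [exact: measurable_scale|exact: measurable_fst].
  by apply: measurableT_comp; [exact: measurable_scale_tuple|exact: measurable_snd].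
pose cn := NngNum (ltW (exprn_gt0 n.+1 c0)).
have [nu nuE] := image_measure (@lebesgue_measure R \x mu n)%E mg.
rewrite /= /lebesgue_tuple_step /pushforward.
rewrite (_ : @cons_tuple_pair R n @^-1` (@scale_tuple n.+1 c @^-1` A) =
  g @^-1` (@cons_tuple_pair R n @^-1` A)); last first.
  apply/seteqP; split => -[x t] /=;
  rewrite (_ : scale_tuple c _ = cons_tuple_pair (g (x, t)))//;
  exact: val_inj.
rewrite -nuE -[RHS]/(mscale cn nu _); apply: product_measure_unique; last first.
  by rewrite -[X in measurable X]setTI; exact: measurable_cons_tuple_pair.
move=> B C mB mC; rewrite -[LHS]/((c ^+ n.+1)%:E * nu (B `*` C))%E nuE.
rewrite (_ : g @^-1` _ = (( *%R c : mR -> mR) @^-1` B) `*` (@scale_tuple n c @^-1` C)) //.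
have mB' : measurable (( *%R c : mR -> mR) @^-1` B).
  by rewrite -[X in measurable X]setTI; exact: measurable_scale.
have mC' : measurable (@scale_tuple n c @^-1` C).
  by rewrite -[X in measurable X]setTI; exact: measurable_scale_tuple.
transitivity ((c ^+ n.+1)%:E * (lebesgue_measure (( *%R c : mR -> mR) @^-1` B) *
    mu n (@scale_tuple n c @^-1` C)))%E.
  by congr (_ * _)%E; exact: product_measure1E.
rewrite exprS EFinM muleACA; congr (_ * _)%E; last by rewrite (IH C).
exact/esym/lebesgue_measure_scale.
Qed.
End scaling.

Section balls.
Variable R : realType.
Local Notation mR := (measurableTypeR R).
Local Notation mu n := (lebesgue_tuple R n).

Definition tnorm n (t : n.-tuple mR) : R := enorm (\row_(i < n) tnth t i).

Lemma tnorm_ge0 n (t : n.-tuple mR) : 0 <= tnorm t.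
Proof. exact: enorm_ge0. Qed.

Lemma measurable_tnorm n : measurable_fun setT (@tnorm n).
Proof.
rewrite (_ : @tnorm n = @Num.sqrt R \o (fun t => \sum_(i < n) tnth t i ^+ 2)).
  apply: measurableT_comp; first by apply: continuous_measurable_fun; exact: sqrt_continuous.
  apply: measurable_sum => i; apply: measurable_funX; exact: measurable_tnth.
apply/funext => t; rewrite /tnorm /enorm/=; congr Num.sqrt.
by apply: eq_bigr => i _; rewrite mxE.
Qed.

Lemma tnorm_scale n (c : R) (t : n.-tuple mR) : 0 <= c ->
  tnorm (scale_tuple c t) = c * tnorm t.
Proof.
move=> c0; rewrite /tnorm /enorm -[in RHS](ger0_norm c0) -sqrtr_sqr -sqrtrM ?sqr_ge0//.
congr Num.sqrt; rewrite mulr_sumr; apply: eq_bigr => i _.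
by rewrite !mxE tnth_map exprMn.
Qed.

Lemma measurable_tball n (r : R) : measurable [set t : n.-tuple mR | tnorm t < r].
Proof.
rewrite (_ : mkset _ = @tnorm n @^-1` `]-oo, r[%classic).
  by rewrite -[X in measurable X]setTI; apply: measurable_tnorm.
by apply/seteqP; split => t /=; rewrite in_itv.
Qed.

Definition cube n (a : R) : set (n.-tuple mR) :=
  [set t | forall i, `|tnth t i| <= a].

Lemma measurable_cube n a : measurable (@cube n a).
Proof.
rewrite (_ : @cube n a = \bigcap_(i in [set: 'I_n])
    ((fun t : n.-tuple mR => tnth t i) @^-1` `[- a, a]%classic)).
  apply: fin_bigcap_measurable => // i _.
  by rewrite -[X in measurable X]setTI; apply: measurable_tnth.
by apply/seteqP; split => t /= H i; have := H i; rewrite /= in_itv/= ler_norml//; apply.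
Qed.

Lemma cube_fin n a : (mu n (@cube n a) < +oo)%E.
Proof.
elim: n => [|n IH]; first by rewrite /= diracE; case: (_ \in _); rewrite ltry.
rewrite /= /lebesgue_tuple_step /pushforward.
rewrite (_ : _ @^-1` _ = `[- a, a]%classic `*` @cube n a); last first.
  apply/seteqP; split => -[x t] /=.
    move=> H; split; first by have := H ord0; rewrite in_itv/= ler_norml.
    by move=> i; have := H (lift ord0 i); rewrite tnthS.
  move=> [+ H] i; rewrite in_itv/= -ler_norml => Hx.
  by case: (unliftP ord0 i) => [j ->|->]; rewrite ?tnthS//; exact: H.
rewrite product_measure1E//=; last exact: measurable_cube.
apply: lte_mul_pinfty => //.
  rewrite ge0_fin_numE// lebesgue_measure_itv/=; case: ifP => _; rewrite ?ltry//.
Qed.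

(** A ball lies in a cube, whose measure is a finite product. *)
Lemma tball_fin n (r : R) : (mu n [set t | (tnorm t < r)%R] < +oo)%E.
Proof.
apply: le_lt_trans (cube_fin n r); apply: le_measure; rewrite ?inE.
- exact: measurable_tball.
- exact: measurable_cube.
move=> t /= tr i; apply: le_trans (ltW tr).
rewrite -sqrtr_sqr /tnorm /enorm ler_wsqrtr// (bigD1 i)//= mxE lerDl.
by apply: sumr_ge0 => *; exact: sqr_ge0.
Qed.

(** All that the volume comparison needs to know about Lebesgue measure on
    [R^n]: the actual value of the constant cancels out. *)
Lemma tball_measure n : exists2 om : R, 0 <= om &
  forall r, 0 < r -> mu n [set t | tnorm t < r] = (om * r ^+ n)%:E.
Proof.
exists (fine (mu n [set t | tnorm t < 1])); first exact: fine_ge0.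
move=> r r0; rewrite (lebesgue_tuple_scale r0); last exact: measurable_tball.
rewrite mulrC EFinM fineK; last by rewrite ge0_fin_numE// tball_fin.
congr (_ * mu n _)%E; apply/seteqP; split => t /=;
  by rewrite tnorm_scale ?ltW// gtr_pMr.
Qed.
End balls.

(** * Integrals of radial functions *)

Section radial.
Variables (R : realType) (n : nat).
Local Notation mR := (measurableTypeR R).
Local Notation mu := (lebesgue_tuple R n).

Definition shell (a b : R) : set (n.-tuple mR) := [set t | a <= tnorm t < b].

Lemma shellE a b : shell a b = [set t | tnorm t < b] `\` [set t | tnorm t < a].
Proof.
apply/seteqP; split => t; rewrite /shell/= leNgt.
  by move=> /andP[/negP ? ?].
by move=> [-> /negP ->].
Qed.

Lemma measurable_shell a b : measurable (shell a b).
Proof. by rewrite shellE; apply: measurableD; exact: measurable_tball. Qed.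

Variable om : R.
Hypothesis om0 : 0 <= om.
Hypothesis omE : forall r : R, 0 < r ->
  mu [set t | tnorm t < r] = (om * r ^+ n)%:E.

Lemma shell_measure a b : 0 < a -> a <= b ->
  mu (shell a b) = (om * (b ^+ n - a ^+ n))%:E.
Proof.
move=> a0 ab; rewrite shellE measureD; [|exact: measurable_tball..|].
  rewrite [X in (_ - mu X)%E](_ : _ = [set t | tnorm t < a]).
    by rewrite [X in (_ - X)%E]omE// [X in (X - _)%E]omE ?(lt_le_trans a0)// mulrBr EFinB.
  by apply/seteqP; split => t /=; [case|move=> ta; split => //; exact: lt_le_trans ab].
exact: tball_fin.
Qed.

Section ball_integral.
Variable F : R -> R.
Hypotheses (cF : continuous F) (F0 : forall x, 0 <= F x).

Definition ball_integral (r : R) : \bar R :=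
  (\int[mu]_(t in [set t | (tnorm t < r)%R]) (F (tnorm t))%:E)%E.

Lemma measurable_radial (D : set (n.-tuple mR)) :
  measurable_fun D (fun t => (F (tnorm t))%:E).
Proof.
apply: measurable_funTS; apply/measurable_EFinP.
apply: (measurableT_comp (f := F)); last exact: measurable_tnorm.
exact: continuous_measurable_fun.
Qed.

Lemma ball_integral_ge0 r : (0 <= ball_integral r)%E.
Proof. by apply: integral_ge0 => t _; rewrite lee_fin. Qed.

Lemma ball_integral_le (r M : R) : 0 < r -> (forall x, 0 <= x <= r -> F x <= M) ->
  (ball_integral r <= (M * (om * r ^+ n))%:E)%E.
Proof.
move=> r0 FM; rewrite EFinM -omE// -integral_cst; last exact: measurable_tball.
apply: ge0_le_integral => //.
- exact: measurable_tball.
- by move=> t _; rewrite lee_fin.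
- exact: measurable_radial.
- by move=> t tr; rewrite lee_fin FM// tnorm_ge0 ltW.
Qed.

Lemma ball_integral_fin (r : R) : 0 < r -> ball_integral r \is a fin_num.
Proof.
move=> r0; rewrite ge0_fin_numE ?ball_integral_ge0//.
have [c _ Fc] := EVT_max (ltW r0) (continuous_subspaceT cF).
by apply: le_lt_trans (ball_integral_le r0 Fc) _; rewrite ltry.
Qed.

Lemma ball_integral_shell a b : a <= b ->
  ball_integral b = (ball_integral a + \int[mu]_(t in shell a b) (F (tnorm t))%:E)%E.
Proof.
move=> ab; rewrite -ge0_integral_setU//=.
- congr (integral _ _ _); apply/seteqP; split => t; rewrite /shell/=.
    by case: (ltP (tnorm t) a) => // _ ?; [left|right].
  by move=> [ta|/andP[]//]; exact: lt_le_trans ab.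
- exact: measurable_tball.
- exact: measurable_shell.
- exact: measurable_radial.
- by move=> t _; rewrite lee_fin.
- apply/disj_set2P; apply/seteqP; split => t //=; rewrite /shell/= => -[+ /andP[]].
  by rewrite ltNge => /negP.
Qed.

Lemma ball_integral_increment a b m M : 0 < a -> a <= b ->
  (forall x, a <= x <= b -> m <= F x <= M) ->
  m * (om * (b ^+ n - a ^+ n)) <= fine (ball_integral b) - fine (ball_integral a)
   <= M * (om * (b ^+ n - a ^+ n)).
Proof.
move=> a0 ab mM.
have b0 : 0 < b by exact: lt_le_trans ab.
have mM' t : shell a b t -> m <= F (tnorm t) <= M.
  by move=> /andP[at_ tb]; rewrite mM// at_ ltW.
have M0 : 0 <= M by have /mM/andP[_] : a <= a <= b; [rewrite lexx|apply: le_trans].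
suff : ((m * (om * (b ^+ n - a ^+ n)))%:E <= \int[mu]_(t in shell a b) (F (tnorm t))%:E
   <= (M * (om * (b ^+ n - a ^+ n)))%:E)%E.
  have := ball_integral_shell ab.
  rewrite -(fineK (ball_integral_fin a0)) -(fineK (ball_integral_fin b0)).
  case: (integral _ _ _) => [r| |]//=; rewrite -EFinD => -[->].
  by rewrite addrAC subrr add0r !lee_fin.
have mS := measurable_shell a b.
apply/andP; split.
  have [m0|m0] := leP 0 m; last first.
    apply: (@le_trans _ _ 0%E); last by apply: integral_ge0 => t _; rewrite lee_fin.
    rewrite lee_fin nmulr_rle0// mulr_ge0// subr_ge0 lerXn2r// nnegrE ltW//.
  rewrite EFinM -shell_measure// -integral_cst//; apply: ge0_le_integral => //.
  - exact: measurable_radial.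
  - by move=> t /mM' /andP[]; rewrite lee_fin.
rewrite EFinM -shell_measure// -integral_cst//; apply: ge0_le_integral => //.
- by move=> t _; rewrite lee_fin.
- exact: measurable_radial.
- by move=> t /mM' /andP[]; rewrite lee_fin.
Qed.

(** On a thin shell [F (tnorm t)] differs from [F r] by at most [e], and the
    shell between the radii [r] and [r + h] has measure [om ((r + h)^n - r^n)]
    up to sign. *)
Lemma ball_integral_near (r e : R) : 0 < r -> 0 < e ->
  \forall h \near 0, `|fine (ball_integral (r + h)) - fine (ball_integral r)
    - F r * (om * ((r + h) ^+ n - r ^+ n))| <= e * `|om * ((r + h) ^+ n - r ^+ n)|.
Proof.
move=> r0 e0.
have /cvgrPdist_le/(_ e e0) [d /= d0 dF] := @cF r.
exists (Num.min d r) => /=; first by rewrite lt_min d0 r0.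
move=> h /=; rewrite sub0r normrN lt_min => /andP[hd hr].
have Fe x : `|r - x| < d -> F r - e <= F x <= F r + e.
  by move=> /dF/=; rewrite -ler_distlC distrC.
have [h0|/ltW h0] := leP 0 h.
- have rh : r <= r + h by rewrite lerDl.
  have Fx x : r <= x <= r + h -> F r - e <= F x <= F r + e.
    move=> /andP[xr xh]; apply: Fe; rewrite ler0_norm ?subr_le0//.
    by move: hd; rewrite ger0_norm// opprB; lra.
  have /andP[] := ball_integral_increment r0 rh Fx.
  have P0 : 0 <= om * ((r + h) ^+ n - r ^+ n).
    by rewrite mulr_ge0// subr_ge0 lerXn2r// nnegrE; lra.
  rewrite (ger0_norm P0) ler_norml; move: (om * _) => P; lra.
- rewrite ler0_norm// in hd hr.
  have rh : r + h <= r by rewrite gerDl.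
  have r0' : 0 < r + h by lra.
  have Fx x : r + h <= x <= r -> F r - e <= F x <= F r + e.
    move=> /andP[xr xh]; apply: Fe; rewrite ger0_norm ?subr_ge0//; lra.
  have /andP[] := ball_integral_increment r0' rh Fx.
  have P0 : 0 <= om * (r ^+ n - (r + h) ^+ n).
    by rewrite mulr_ge0// subr_ge0 lerXn2r// nnegrE; lra.
  rewrite -(opprB (r ^+ n)) mulrN normrN (ger0_norm P0) ler_norml.
  move: (om * _) P0 => P P0; lra.
Qed.

(** Polar coordinates in differential form: the integral over the ball of
    radius [r] has the same derivative in [r] as [F r] times its volume would
    have with [F r] frozen. *)
Lemma is_derive_ball_integral (r : R) : 0 < r ->
  is_derive r 1 (fine \o ball_integral) (F r * (om * (n%:R * r ^+ n.-1))).
Proof.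
move=> r0; set H := fine \o ball_integral; pose P (x : R) := om * x ^+ n.
have dP : is_derive r 1 P (om * (n%:R * r ^+ n.-1)).
  rewrite (_ : P = om *: (id : R -> R) ^+ n); last first.
    by apply/funext => x; rewrite /P/= !fctE.
  apply: is_derive_eq.
  by rewrite /GRing.scale/= mulr1.
set P' := om * _ in dP *.
have cP : (fun h => h^-1 *: (P (h *: 1 + r) - P r)) @ 0^' --> P'.
  by have [? <-] := dP.
suff cH : (fun h => h^-1 *: (H (h *: 1 + r) - H r)) @ 0^' --> F r * P'.
  by apply: DeriveDef; [apply/cvg_ex; exists (F r * P')|exact: cvg_lim cH].
have ce : (fun h => h^-1 *: (H (h *: 1 + r) - H r) -
    F r * (h^-1 *: (P (h *: 1 + r) - P r))) @ 0^' --> (0 : R).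
  apply/cvgrPdist_le => e e0.
  have k0 : 0 < `|P'| + 1 by rewrite ltr_wpDl.
  near=> h; rewrite sub0r normrN.
  have Q1 : `|h^-1 *: (P (h *: 1 + r) - P r)| <= `|P'| + 1.
    near: h; move/cvgrPdist_le : cP => /(_ 1 ltr01); apply: filterS => h /= Hh.
    by rewrite -lerBlDl; apply: le_trans (lerB_dist _ _) _; rewrite distrC.
  have : `|H (r + h) - H r - F r * (om * ((r + h) ^+ n - r ^+ n))| <=
      (e / (`|P'| + 1)) * `|om * ((r + h) ^+ n - r ^+ n)|.
    near: h; apply: cvg_within; exact: ball_integral_near (divr_gt0 e0 k0).
  move: Q1; rewrite /P /GRing.scale/= mulr1 (addrC h) -mulrBr.
  move: (H _ - H r) (om * (_ - _)) => a b Q1 Q2.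
  rewrite mulrCA -mulrBr normrM.
  apply: (@le_trans _ _ (`|h^-1| * (e / (`|P'| + 1) * `|b|))).
    by rewrite ler_wpM2l.
  rewrite mulrCA -normrM; apply: le_trans (ler_wpM2l _ Q1) _.
    by rewrite ltW// divr_gt0.
  by rewrite divfK// gt_eqF.
rewrite -[X in _ --> X]add0r.
rewrite (_ : (fun h => _) = (fun h => (h^-1 *: (H (h *: 1 + r) - H r) -
    F r * (h^-1 *: (P (h *: 1 + r) - P r))) +
    F r * (h^-1 *: (P (h *: 1 + r) - P r)))); last first.
  by apply/funext => h; rewrite subrK.
exact: (cvgD ce (cvgM (cvg_cst _) cP)).
Unshelve. all: by end_near. Qed.
End ball_integral.

Lemma ball_integral_le_setT (F : R -> R) r : continuous F -> (forall x, 0 <= F x) ->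
  (ball_integral F r <= \int[mu]_t (F (tnorm t))%:E)%E.
Proof.
move=> cF F0; apply: ge0_subset_integral => //.
- exact: measurable_tball.
- exact: measurable_radial.
- by move=> t _; rewrite lee_fin.
Qed.

(** The hypothesis says that the radial map of profile [rho] sends the density
    [F] to one dominated by [G].  Hence the [G]-mass of the ball of radius
    [rho r] grows faster in [r] than the [F]-mass of the ball of radius [r];
    the latter vanishes as [r] tends to [0], and letting [r] tend to infinity
    compares the total masses. *)
Lemma radial_integral_comparison (F G rho drho : R -> R) : (0 < n)%N ->
  continuous F -> continuous G -> (forall x, 0 <= F x) -> (forall x, 0 <= G x) ->
  (forall r : R, 0 < r -> is_derive r 1 rho (drho r)) ->
  (forall r : R, 0 < r -> 0 < rho r) ->
  (forall r : R, 0 < r ->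
     F r * r ^+ n.-1 <= G (rho r) * rho r ^+ n.-1 * drho r) ->
  (\int[mu]_t (F (tnorm t))%:E <= \int[mu]_t (G (tnorm t))%:E)%E.
Proof.
move=> n0 cF cG F0 G0 drhoE rho0 FG.
pose D r := fine (ball_integral G (rho r)) - fine (ball_integral F r).
have D_ge a b : 0 < a -> a <= b -> D a <= D b.
  move=> a0 ab.
  apply: (ge0_is_derive_le (df := fun r =>
      G (rho r) * (om * (n%:R * rho r ^+ n.-1)) * drho r -
      F r * (om * (n%:R * r ^+ n.-1)))) => // x /andP[]; [|move=> /ltW] => ax _;
    have x0 : 0 < x by exact: lt_le_trans ax.
    apply: (is_deriveB (f := (fine \o ball_integral G) \o rho)).
      apply: is_derive1_comp; last exact: drhoE.
      by apply: is_derive_ball_integral => //; exact: rho0.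
    exact: is_derive_ball_integral.
  rewrite (_ : _ - _ = om * n%:R *
    (G (rho x) * rho x ^+ n.-1 * drho x - F x * x ^+ n.-1)); last by ring.
  by rewrite mulr_ge0// ?mulr_ge0// subr_ge0 FG.
have [c _ Fc] := EVT_max ler01 (continuous_subspaceT cF).
have Fle r : 0 < r -> (ball_integral F r <= ball_integral G (rho r))%E.
  move=> r0.
  rewrite -(fineK (ball_integral_fin cF F0 r0)).
  rewrite -(fineK (ball_integral_fin cG G0 (rho0 r r0))).
  rewrite lee_fin -subr_ge0 -/(D r); apply/ler_addgt0Pr => e e0.
  have K0 : 0 <= F c * om by rewrite mulr_ge0.
  (* [F <= F c] on the unit interval, so the ball of radius [d <= 1] has
     [F]-mass at most [F c * om * d ^+ n <= F c * om * d <= e] *)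
  pose d := Num.min (Num.min 1 r) (e / (F c * om + 1)).
  have d0 : 0 < d by rewrite !lt_min ltr01 r0 divr_gt0// ltr_wpDl.
  have [d1 dr de] : [/\ d <= 1, d <= r & d <= e / (F c * om + 1)].
    by rewrite /d !ge_min !lexx !orbT.
  rewrite -lerBlDr sub0r; apply: le_trans (D_ge _ _ d0 dr).
  have : (ball_integral F d <= (F c * (om * d ^+ n))%:E)%E.
    apply: ball_integral_le => // x /andP[x0 xd]; apply: Fc.
    by rewrite in_itv/= x0 (le_trans xd).
  rewrite -(fineK (ball_integral_fin cF F0 d0)) lee_fin => HF.
  have HG : 0 <= fine (ball_integral G (rho d)) by apply/fine_ge0/ball_integral_ge0.
  have dn : d ^+ n <= d by rewrite -(prednK n0) exprS ler_piMr ?exprn_ile1// ltW.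
  have : F c * om * d ^+ n <= e.
    apply: le_trans (ler_wpM2l K0 (le_trans dn de)) _.
    by rewrite mulrA ler_pdivrMr ?ltr_wpDl// mulrC ler_pM2l// lerDl.
  rewrite /D; move: HF HG; rewrite mulrA; lra.
pose B (k : nat) : set (n.-tuple mR) := [set t | tnorm t < k.+1%:R].
have -> : (\int[mu]_t (F (tnorm t))%:E = \int[mu]_(t in \bigcup_k B k) (F (tnorm t))%:E)%E.
  congr integral; apply/esym/seteqP; split => // t _.
  exists (Num.bound (tnorm t)) => //=.
  have tk := archi_boundP (tnorm_ge0 t).
  by apply: lt_trans tk _; rewrite ltr_nat.
have ndB : nondecreasing_seq B.
  move=> k l kl; apply/subsetPset => t /= /lt_le_trans; apply.
  by rewrite ler_nat.
have := @ge0_nondecreasing_set_cvg_integral _ _ R B (fun t => (F (tnorm t))%:E) mu ndB.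
have FB k (t : n.-tuple mR) : B k t -> (0 <= (F (tnorm t))%:E)%E by rewrite lee_fin.
have FB' k : measurable_fun (B k) (fun t => (F (tnorm t))%:E) by exact: measurable_radial.
move=> /(_ (fun k => measurable_tball _) FB' FB) cvB.
apply: (cvge_le _ cvB); near=> k.
apply: le_trans (Fle k.+1%:R _) _ => //.
exact: ball_integral_le_setT.
Unshelve. all: by end_near. Qed.
End radial.

(** * Comparison of the warping function with the sine *)

(** Integrating from [-1] makes the primitive differentiable on both sides of
    [0], which is where the distance from the origin is measured from. *)
Lemma primitive_exists (R : realType) (U : R -> R) : continuous U ->
  exists s : R -> R, s 0 = 0 /\ forall x : R, 0 <= x -> is_derive x 1 s (U x).
Proof.
move=> cU; pose I (x : R) := (\int[lebesgue_measure]_(t in `[(-1)%R, x]) U t)%R.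
have dI (x : R) : 0 <= x -> is_derive x 1 I (U x).
  move=> x0.
  have iU : lebesgue_measure.-integrable `[(-1)%R, x + 1] (EFin \o U).
    apply: continuous_compact_integrable; first exact: segment_compact.
    exact: continuous_subspaceT.
  have [||dI IE] := @continuous_FTC1_closed _ U (-1) x (x + 1) _ iU _ (cU x).
  - by rewrite ltrDl.
  - by rewrite (lt_le_trans _ x0).
  by apply: DeriveDef; [exact: dI|rewrite -derive1E; exact: IE].
exists (fun x => I x - I 0); split; first by rewrite subrr.
move=> x x0; rewrite -[U x]subr0.
by apply: is_deriveB; exact: dI.
Qed.

Section comparison.
Variables (R : realType) (v v1 v2 s : R -> R).
Hypothesis dv : forall x : R, is_derive x 1 v (v1 x).
Hypothesis dv1 : forall x : R, is_derive x 1 v1 (v2 x).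
Hypothesis ric : forall r : R, 0 < r -> v2 r + v1 r / r + expR (2 * v r) <= 0.
Hypothesis s0 : s 0 = 0.
Hypothesis ds : forall x : R, 0 <= x -> is_derive x 1 s (expR (v x)).

Lemma geodesic_radius_le (a b : R) : 0 <= a -> a <= b -> s a <= s b.
Proof.
move=> a0 ab; apply: (ge0_is_derive_le (df := fun x => expR (v x))) => // x.
  by move=> /andP[ax _]; apply: ds; exact: le_trans ax.
Qed.

Lemma geodesic_radius_ge0 (a : R) : 0 <= a -> 0 <= s a.
Proof. by move=> a0; rewrite -[0]s0; exact: geodesic_radius_le. Qed.

(** Sturm comparison without a quotient.  In the geodesic radius [s] the
    circumference function [f = r e^v] satisfies [f' = 1 + r v'] and
    [f'' <= - f].  With [r] fixed, the solution of [y'' = - y] that agrees with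
    [f] to first order at [t] takes at [r] the value
    [f(t) cos(s(r) - s(t)) + f'(t) sin(s(r) - s(t))], and moving the point [t]
    from [0] to [r] can only decrease it, from [sin (s r)] to [f(r)]. *)
Lemma warp_le_sin_below_pi (r : R) : 0 <= r -> s r <= pi -> r * expR (v r) <= sin (s r).
Proof.
move=> r0 spi.
pose E t := t * expR (v t) * cos (s r - s t) + (1 + t * v1 t) * sin (s r - s t).
pose dE t := (expR (v t) ^+ 2 * t + v1 t + t * v2 t) * sin (s r - s t).
suff : E r <= E 0.
  by rewrite /E subrr s0 sin0 cos0 subr0 !mul0r addr0 mulr1 mulr0 add0r addr0 mul1r.
suff : - E 0 <= - E r by rewrite lerN2.
apply: (ge0_is_derive_le (df := fun t => - dE t) (f := fun t => - E t) r0) => t.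
  move=> /andP[t0 tr].
  have dI := is_derive_id t (1 : R).
  have dexp := is_derive1_comp (is_derive_expR (v t)) (dv t).
  have darg := is_deriveB (is_derive_cst (s r) t (1 : R)) (ds t0).
  have dcos := @is_derive1_comp _ cos (cst (s r) - s) t _ _ (is_derive_cos _) darg.
  have dsin := @is_derive1_comp _ sin (cst (s r) - s) t _ _ (is_derive_sin _) darg.
  have df' := is_deriveD (is_derive_cst (1 : R) t (1 : R)) (is_deriveM dI (dv1 t)).
  apply: is_deriveN.
  have -> : E = (id * (expR \o v)) * (cos \o (cst (s r) - s)) +
      (cst 1 + id * v1) * (sin \o (cst (s r) - s)).
    by apply/funext => x; rewrite /E !fctE.
  apply: is_derive_eq (is_deriveD (is_deriveM (is_deriveM dI dexp) dcos)
    (is_deriveM df' dsin)) _.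
  rewrite /dE /GRing.scale/= !fctE/=.
  by ring.
move=> /andP[t0 tr]; rewrite oppr_ge0 /dE mulr_le0_ge0//; last first.
  apply: sin_ge0_pi; have := geodesic_radius_le (ltW t0) (ltW tr); have := geodesic_radius_ge0 (ltW t0).
  by move=> ? ?; apply/andP; split; lra.
have -> : expR (v t) ^+ 2 * t + v1 t + t * v2 t = t * (v2 t + v1 t / t + expR (2 * v t)).
  rewrite -expRM_natl.
  by field; exact: lt0r_neq0.
by rewrite pmulr_rle0// ric.
Qed.

(** If [s] reached [pi], the previous bound at that point would give
    [r e^v <= sin pi = 0]. *)
Lemma geodesic_radius_lt_pi (r : R) : 0 <= r -> s r < pi.
Proof.
move=> r0; rewrite ltNge; apply/negP => spi.
have cs : {within `[0, r], continuous s}.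
  by apply: derivable_within_continuous => x; rewrite in_itv/= => /andP[/ds[]].
have [|c] := IVT (v := pi) r0 cs.
  by rewrite s0 ge_min le_max spi pi_ge0 orbT.
rewrite in_itv/= => /andP[c0 _] sc.
have {}c0 : 0 < c.
  rewrite lt_neqAle c0 andbT; apply/eqP => c_eq0.
  by have := pi_gt0 R; rewrite -sc -c_eq0 s0 ltxx.
have := @warp_le_sin_below_pi c (ltW c0); rewrite sc lexx sinpi => /(_ isT).
by rewrite leNgt mulr_gt0// expR_gt0.
Qed.

Lemma warp_le_sin (r : R) : 0 <= r -> r * expR (v r) <= sin (s r).
Proof. by move=> r0; apply: warp_le_sin_below_pi => //; rewrite ltW// geodesic_radius_lt_pi. Qed.

(** Otherwise [s' >= e / r] from some point on, so that [s] would dominate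
    [e ln r] and be unbounded. *)
Lemma warp_small (a e : R) : 0 < e -> exists r, [/\ a <= r, 0 < r & r * expR (v r) <= e].
Proof.
move=> e0; pose m := Num.max a 1.
have m0 : 0 < m by rewrite lt_max ltr01 orbT.
apply: contrapT => H.
have big (r : R) : m <= r -> e < r * expR (v r).
  move=> mr; rewrite ltNge; apply/negP => Hr; apply: H; exists r; split => //.
    by apply: le_trans mr; rewrite le_max lexx.
  exact: lt_le_trans mr.
(* chosen so that [e * ln] increases by exactly [pi] between [m] and [N] *)
pose N := m * expR (pi / e).
have mN : m <= N.
  rewrite ler_peMr ?(ltW m0)//.
  by rewrite -expR0 ler_expR divr_ge0 ?pi_ge0 ?ltW.
have : s m - e * ln m <= s N - e * ln N.
  apply: (ge0_is_derive_le (f := s - e *: @ln R) (df := fun x => expR (v x) - e * x^-1)) => // x.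
    move=> /andP[mx xN]; have x0 := lt_le_trans m0 mx.
    by have dsx := ds (ltW x0); apply: is_deriveB; apply: is_deriveZ; exact: is_derive1_ln.
  move=> /andP[/ltW mx xN]; have x0 := lt_le_trans m0 mx.
  by rewrite subr_ge0 ler_pdivrMr// mulrC ltW// big.
rewrite /N lnM ?posrE ?expR_gt0// expRK mulrDr.
have -> : e * (pi / e) = pi :> R by rewrite mulrC divfK// gt_eqF.
have := geodesic_radius_ge0 (ltW m0); have := geodesic_radius_lt_pi (le_trans (ltW m0) mN).
rewrite -/N; lra.
Qed.

Lemma geodesic_radius_gt0 (r : R) : 0 < r -> 0 < s r.
Proof.
move=> r0; rewrite lt_neqAle geodesic_radius_ge0 ?ltW// andbT; apply/eqP => sr.
have := warp_le_sin (ltW r0); rewrite -sr sin0 leNgt.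
by rewrite mulr_gt0// expR_gt0.
Qed.

Lemma cos_half_gt0 (r : R) : 0 < r -> 0 < cos (s r / 2).
Proof.
move=> r0; have := geodesic_radius_lt_pi (ltW r0); have := geodesic_radius_gt0 r0 => ? ?.
by apply: cos_gt0_pihalf; apply/andP; split; lra.
Qed.

(** The radial coordinate, in the stereographic chart of the round sphere, of
    the point at distance [s r] from the pole. *)
Definition half_tan (r : R) := tan (s r / 2).

Lemma half_tan_gt0 (r : R) : 0 < r -> 0 < half_tan r.
Proof.
move=> r0; have := geodesic_radius_lt_pi (ltW r0); have := geodesic_radius_gt0 r0 => ? ?.
rewrite /half_tan /tan divr_gt0 ?cos_half_gt0//.
by apply: sin_gt0_pi; apply/andP; split; lra.
Qed.

Lemma is_derive_half_tan (r : R) : 0 < r ->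
  is_derive r 1 half_tan ((1 + half_tan r ^+ 2) / 2 * expR (v r)).
Proof.
move=> r0; have c0 := lt0r_neq0 (cos_half_gt0 r0).
have dsr := ds (ltW r0).
have ds2 : is_derive r 1 (fun x => s x / 2) (expR (v r) / 2).
  rewrite (_ : (fun x => s x / 2) = 2^-1 *: s); last first.
    by apply/funext => x; rewrite fctE/= /GRing.scale/= mulrC.
  by apply: is_derive_eq; rewrite /GRing.scale/= mulrC.
have dt : is_derive (s r / 2) 1 tan (1 + half_tan r ^+ 2).
  by rewrite -cos2_tan2//; exact: is_derive_tan.
have := @is_derive1_comp _ tan (fun x => s x / 2) r _ _ dt ds2.
by rewrite mulrA mulrAC.
Qed.

Lemma sin_half_tan (r : R) : 0 < r ->
  sin (s r) = 2 * half_tan r / (1 + half_tan r ^+ 2).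
Proof.
move=> r0; have c0 := lt0r_neq0 (cos_half_gt0 r0).
rewrite -cos2_tan2// invrK /half_tan /tan -{1}[s r](divfK (_ : 2 != 0 :> R))//.
rewrite mulr_natr sin_mulr2n -mulr_natl.
by field.
Qed.

(** After the powers of the Euclidean radii are absorbed, the two sides are
    [f^n e^v] and [sin(s)^n e^v]: the area of the geodesic sphere times the
    radial line element. *)
Lemma radial_transplant n (r : R) : 0 < r ->
  expR (v r) ^+ n.+1 * r ^+ n <=
  (2 / (1 + half_tan r ^+ 2)) ^+ n.+1 * half_tan r ^+ n *
  ((1 + half_tan r ^+ 2) / 2 * expR (v r)).
Proof.
move=> r0; have h0 : 1 + half_tan r ^+ 2 != 0 by rewrite lt0r_neq0// ltr_wpDr// sqr_ge0.
rewrite (_ : expR (v r) ^+ n.+1 * r ^+ n = (r * expR (v r)) ^+ n * expR (v r)); last first.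
  by rewrite exprMn exprS; ring.
rewrite (_ : _ * (_ * expR _) = sin (s r) ^+ n * expR (v r)).
  rewrite ler_pM2r ?expR_gt0//; apply: lerXn2r; rewrite ?nnegrE.
  - by rewrite mulr_ge0 ?expR_ge0// ltW.
  - by rewrite sin_ge0_pi// geodesic_radius_ge0 ?ltW// geodesic_radius_lt_pi// ltW.
  - by rewrite warp_le_sin// ltW.
rewrite sin_half_tan// [2 * _ / _]mulrAC [in RHS]exprMn exprS.
set q := 1 + _ in h0 *; move: (half_tan r ^+ n) ((2 / q) ^+ n) => a b.
by field.
Qed.
End comparison.

(** * Curves and their lengths *)

Section smooth_curves.
Variables (R : realType) (n : nat).
Implicit Types (p q : 'rV[R]_n) (f g : R -> R).

Lemma is_derive_scale_vec f (df t v : R) p : is_derive t 1 f df ->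
  is_derive t v (fun x => f x *: p) ((v * df) *: p).
Proof.
move=> [dft dfE]; have {}dft : differentiable f t by exact/derivable1_diffP.
have dp := @differentiableZl _ _ _ f p t dft.
apply: DeriveDef; first exact: diff_derivable.
rewrite deriveE// diffZl//; congr (_ *: _).
by rewrite -[v in LHS]mulr1 -[v * 1]/(v *: 1) linearZ/= -deriveE// dfE.
Qed.

(** The derivative of [f p + g q] along [v] is [f' (v p) + g' (v q)].  For lines and
    circles this is a combination of the same kind with other vectors, so that an
    induction on the order with [p] and [q] quantified proves smoothness. *)
Lemma class_C_comb (k : nat) f g (f' g' : R -> R) :
  (forall t : R, is_derive t 1 f (f' t)) -> (forall t : R, is_derive t 1 g (g' t)) ->
  (forall p q, class_C k (fun t => f' t *: p + g' t *: q)) ->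
  forall p q, class_C k.+1 (fun t => f t *: p + g t *: q).
Proof.
move=> df dg H p q.
have D (t v : R) : is_derive t v (fun t => f t *: p + g t *: q)
    ((v * f' t) *: p + (v * g' t) *: q).
  by apply: is_deriveD; exact: is_derive_scale_vec.
split.
  move=> t; apply: differentiable_continuous; apply/derivable1_diffP.
  by have [] := D t 1.
move=> v; split; first by move=> t; have [] := D t v.
rewrite (_ : 'D_v _ = fun t => f' t *: (v *: p) + g' t *: (v *: q)); first exact: H.
by apply/funext => t; have [_ ->] := D t v; rewrite !scalerA !(mulrC v).
Qed.

Lemma smooth_line p q : smooth (fun t : R => p + t *: q).
Proof.
suff H k p' q' : class_C k (fun t : R => 1 *: p' + t *: q').
  by move=> k; have := H k p q; under eq_fun do rewrite scale1r.
elim: k p' q' => [|k IH] p' q'.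
  move=> t; apply: cvgD; first exact: cvg_cst.
  by apply: cvgZr_tmp; exact: cvg_id.
have d1 (t : R) : is_derive t 1 (cst 1 : R -> R) (cst 0 t) by exact: is_derive_cst.
have d2 (t : R) : is_derive t 1 (id : R -> R) (cst 1 t) by exact: is_derive_id.
apply: (class_C_comb d1 d2) => p1 q1.
rewrite (_ : (fun t => _) = fun t => 1 *: q1 + t *: 0); first exact: IH.
by apply/funext => t; rewrite scale0r scaler0 addr0 add0r.
Qed.

Lemma smooth_arc (c : R) p q :
  smooth (fun t : R => cos (t + c) *: p + sin (t + c) *: q).
Proof.
have dc (t : R) : is_derive t 1 (fun t => t + c) 1.
  by rewrite -[X in is_derive _ _ _ X]addr0; apply: is_deriveD.
have dcos (t : R) : is_derive t 1 (fun t => cos (t + c)) (- sin (t + c)).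
  rewrite -[X in is_derive _ _ _ X]mulr1.
  exact: (is_derive1_comp (f := @cos R)).
have dsin (t : R) : is_derive t 1 (fun t => sin (t + c)) (cos (t + c)).
  rewrite -[X in is_derive _ _ _ X]mulr1.
  exact: (is_derive1_comp (f := @sin R)).
move=> k; elim: k p q => [|k IH] p q; last first.
  apply: (class_C_comb dcos dsin) => p1 q1.
  rewrite (_ : (fun t => _) = fun t => cos (t + c) *: q1 + sin (t + c) *: - p1).
    exact: IH.
  by apply/funext => t; rewrite scaleNr scalerN addrC.
move=> t; apply: differentiable_continuous; apply/derivable1_diffP.
by apply: derivableD; apply: ex_derive; exact: is_derive_scale_vec.
Qed.
End smooth_curves.

Lemma continuous_derive1_smooth (R : realType) (n : nat) (d : R -> 'rV[R]_n) :
  smooth d -> continuous (derive1 d).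
Proof.
move=> sd; have [_ D1] := sd 1%N; have [_ cD1] := D1 1.
have -> : derive1 d = 'D_1 d by apply/funext => t; rewrite derive1E.
exact: cD1.
Qed.

Section conn.
Variables (R : realType) (n : nat) (w : 'rV[R]_n -> R).
Local Notation mu := (@lebesgue_measure R).

Definition speed (g : R -> 'rV[R]_n) (t : R) : \bar R :=
  (expR (w (g t)) * enorm (derive1 g t))%:E.

Lemma speed_ge0 g t : (0 <= speed g t)%E.
Proof. by rewrite lee_fin mulr_ge0 ?expR_ge0 ?enorm_ge0. Qed.

(** The arbitrary starting time [a] lets two curves be concatenated without
    reparametrization.  The measurability of the speed is carried along because
    the additivity of the integral requires it. *)
Definition joined x y (L : R) := forall a : R, exists b g,
  [/\ a <= b, piecewise_smooth a b g, g a = x /\ g b = y,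
      measurable_fun `[a, b]%classic (speed g) & (conf_length w a b g <= L%:E)%E].

Lemma conf_dist_le x y L : joined x y L -> (conf_dist w x y <= L%:E)%E.
Proof.
move=> /(_ 0) [b [g [ab pg [ga gb] _ gL]]]; apply: le_trans gL.
by apply: ereal_inf_lbound; exists 0, b, g.
Qed.

Lemma joined_le x y L M : joined x y L -> L <= M -> joined x y M.
Proof.
move=> xy LM a; have [b [g [? ? ? ? gL]]] := xy a; exists b, g; split => //.
by apply: le_trans gL _; rewrite lee_fin.
Qed.

(** Concatenation of the two subdivisions; at the common end point [b] the two
    curves take the same value, which settles the closed piece that starts there. *)
Lemma piecewise_smooth_cat (a b c : R) (g1 g2 : R -> 'rV[R]_n) :
  piecewise_smooth a b g1 -> piecewise_smooth b c g2 -> g1 b = g2 b ->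
  piecewise_smooth a c (fun t => if t <= b then g1 t else g2 t).
Proof.
move=> [s1 [P1 H1]] [s2 [P2 H2]] gb; exists (s1 ++ s2); split.
  exact: itv_partition_cat P1 P2.
move=> i; rewrite size_cat => i12.
have [i1|i1] := ltnP i (size s1).
  have [d sd dE] := H1 i i1; exists d => //.
  rewrite -cat_cons !nth_cat/= i1 ltnS (ltnW i1) => t tI.
  rewrite -dE// ifT//; move: tI; rewrite in_itv/= => /andP[_ /le_trans]; apply.
  have := @itv_partition_nth_le _ _ a b s1 i.+1 i1 P1.
  by rewrite /= (set_nth_default a).
have j2 : (i - size s1 < size s2)%N by rewrite ltn_subLR.
have [d sd dE] := H2 _ j2; exists d => //.
have E1 : nth a (s1 ++ s2) i = nth b s2 (i - size s1).
  by rewrite nth_cat ltnNge i1/= (set_nth_default b).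
have E0 : nth a (a :: (s1 ++ s2)) i = nth b (b :: s2) (i - size s1).
  rewrite -cat_cons nth_cat/= ltnS.
  have [->|ni] := eqVneq i (size s1).
    rewrite leqnn subnn -last_nth.
    by have [_ /eqP] := P1.
  have si : (size s1 < i)%N by rewrite ltn_neqAle eq_sym ni.
  rewrite leqNgt si/= subnS.
  case: (i - size s1)%N j2 (subn_gt0 (size s1) i) => [|j] j2 //=; first by rewrite si.
  by move=> _; rewrite (set_nth_default b)// ltnW.
rewrite E0 E1 => t tI; rewrite -dE//.
case: ifPn => // tb.
have bt : b <= t.
  move: tI; rewrite in_itv/= => /andP[+ _]; apply: le_trans.
  have j2' : (i - size s1 < (size s2).+1)%N by rewrite ltnS ltnW.
  by have := itv_partition_nth_ge j2' P2; rewrite (set_nth_default b).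
by rewrite (_ : t = b)//; apply/eqP; rewrite eq_le tb.
Qed.

Hypothesis cw : continuous w.

(** The speed of the concatenation is that of one of the two curves except at
    the junction, a single point. *)
Lemma joined_trans x y z L M : joined x y L -> joined y z M -> joined x z (L + M).
Proof.
move=> xy yz a; have [b [g1 [ab p1 [g1a g1b] m1 L1]]] := xy a.
have [c [g2 [bc p2 [g2b g2c] m2 L2]]] := yz b.
pose g t := if t <= b then g1 t else g2 t.
have g12 : g1 b = g2 b by rewrite g1b g2b.
have sp1 t : t < b -> speed g t = speed g1 t.
  move=> tb; rewrite /speed /g (ltW tb); congr (_ * enorm _)%:E.
  rewrite !derive1E; apply: near_eq_derive.
  by near=> t'; rewrite ifT// ltW//; near: t'; exact: lt_nbhsl.
have sp2 t : b < t -> speed g t = speed g2 t.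
  move=> bt; rewrite /speed /g leNgt bt/=; congr (_ * enorm _)%:E.
  rewrite !derive1E; apply: near_eq_derive.
  by near=> t'; rewrite ifF// leNgt; apply/negbTE/negPn; near: t'; exact: lt_nbhsr.
have m1' : measurable_fun `[a, b[ (speed g).
  apply: (eq_measurable_fun (speed g1)).
    by move=> t; rewrite inE/= in_itv/= => /andP[_ tb]; rewrite sp1.
  by apply: measurable_funS m1 => //; apply: subset_itvl; rewrite bnd_simp.
have m2' : measurable_fun `]b, c] (speed g).
  apply: (eq_measurable_fun (speed g2)).
    by move=> t; rewrite inE/= in_itv/= => /andP[tb _]; rewrite sp2.
  by apply: measurable_funS m2 => //; apply: subset_itvr; rewrite bnd_simp.
have m1'' : measurable_fun `[a, b] (speed g).
  move: ab m1'; rewrite le_eqVlt => /predU1P[->|ab] m1'.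
    by rewrite set_itv1; exact: measurable_fun_set1.
  rewrite -(@setUitv1 _ _ (BLeft a) b true); last by rewrite bnd_simp ltW.
  apply/(measurable_funU _ (measurable_itv _) (measurable_set1 b)).
  by split; [exact: m1'|exact: measurable_fun_set1].
have acE : `[a, c]%classic = `[a, b] `|` `]b, c].
  by rewrite -itv_bndbnd_setU// bnd_simp.
have mac : measurable_fun `[a, c] (speed g).
  rewrite acE; apply/(measurable_funU _ (measurable_itv _) (measurable_itv _)).
  by split; [exact: m1''|exact: m2'].
exists c, g; split => //.
- exact: le_trans bc.
- exact: piecewise_smooth_cat.
- rewrite /g ab; split => //; case: ifPn => // cb.
  have {}cb : c = b by apply/eqP; rewrite eq_le bc cb.
  by rewrite -g2c cb.
rewrite EFinD; apply: le_trans (leeD L1 L2).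
have dis : [disjoint `[a, b]%classic & `]b, c]%classic].
  apply/disj_set2P; apply/seteqP; split => // t [] /=; rewrite !in_itv/=.
  by move=> /andP[_ tb] /andP[bt _]; move: bt; rewrite ltNge tb.
rewrite acE in mac.
have -> : (conf_length w a c g = \int[mu]_(t in `[a, b]) speed g t +
    \int[mu]_(t in `]b, c]) speed g t)%E.
  have := ge0_integral_setU mu (measurable_itv _) (measurable_itv _) mac
    (fun t _ => speed_ge0 g t) dis.
  by rewrite -acE.
have m1b : measurable_fun `[a, b[ (speed g1).
  by apply: measurable_funS m1 => //; apply: subset_itvl; rewrite bnd_simp.
have m2b : measurable_fun `]b, c] (speed g2).
  by apply: measurable_funS m2 => //; apply: subset_itvr; rewrite bnd_simp.
have E1 : (\int[mu]_(t in `[a, b[) speed g t = \int[mu]_(t in `[a, b[) speed g1 t)%E.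
  by apply: eq_integral => t; rewrite inE/= in_itv/= => /andP[_ tb]; exact: sp1.
have E2 : (\int[mu]_(t in `]b, c]) speed g t = \int[mu]_(t in `]b, c]) speed g2 t)%E.
  by apply: eq_integral => t; rewrite inE/= in_itv/= => /andP[bt _]; exact: sp2.
have I1 := integral_itv_bndo_bndc m1'.
have I2 := integral_itv_bndo_bndc m1b.
have I3 := integral_itv_obnd_cbnd m2b.
have eq_lee (x0 y0 : \bar R) : x0 = y0 -> (x0 <= y0)%E by move=> ->.
apply: leeD.
  apply: eq_lee; exact: etrans (etrans (esym I1) E1) I2.
apply: eq_lee; exact: etrans E2 I3.
Unshelve. all: by end_near. Qed.
End conn.

Section pieces.
Variables (R : realType) (n : nat) (w : 'rV[R]_n -> R).
Hypothesis cw : continuous w.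
Local Notation mu := (@lebesgue_measure R).

Lemma continuous_speed (g : R -> 'rV[R]_n) : smooth g ->
  continuous (fun t => expR (w (g t)) * enorm (derive1 g t)).
Proof.
move=> sg t; apply: cvgM.
  apply: (continuous_comp (g := expR)); last exact: continuous_expR.
  by apply: continuous_comp; [exact: (sg 0%N)|exact: cw].
by apply: continuous_comp; [exact: continuous_derive1_smooth|exact: continuous_enorm].
Qed.

Lemma joined_smooth x y L l (g : R -> R -> 'rV[R]_n) : 0 <= l ->
  (forall a, smooth (g a)) -> (forall a, g a a = x) -> (forall a, g a (a + l) = y) ->
  (forall a, conf_length w a (a + l) (g a) <= L%:E)%E -> joined w x y L.
Proof.
move=> l0 sg gx gy gL a; exists (a + l), (g a); split => //.
- by rewrite lerDl.
- have [->|ln0] := eqVneq l 0; first by exists [::]; rewrite addr0; split.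
  exists [:: a + l]; split; first by apply: itv_partition1; rewrite ltrDl lt_neqAle eq_sym ln0.
  by case=> // _; exists (g a).
- apply: measurable_funTS; apply/measurable_EFinP; apply: continuous_measurable_fun.
  exact: continuous_speed.
Qed.

Variables (v s : R -> R).
Hypothesis cv : continuous v.
Hypothesis ds : forall r : R, 0 <= r -> is_derive r 1 s (expR (v r)).
Hypothesis wv : forall (r : R) (p : 'rV[R]_n), 0 <= r -> enorm p = 1 -> w (r *: p) = v r.

Lemma derive1_line (p q : 'rV[R]_n) t : derive1 (fun t : R => p + t *: q) t = q.
Proof.
rewrite derive1E.
have D := is_deriveD (is_derive_cst p t (1 : R))
  (is_derive_scale_vec 1 q (is_derive_id t (1 : R))).
by have [_ ->] := D; rewrite add0r mulr1 scale1r.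
Qed.

(** Along a ray the length element is [s'], whether the curve goes outwards or
    inwards; the sign [sg] of [d] treats both cases at once. *)
Lemma joined_radial (p : 'rV[R]_n) (r d sg : R) : enorm p = 1 -> 0 <= r -> 0 <= r + d ->
  sg * d = `|d| -> joined w (r *: p) ((r + d) *: p) (sg * (s (r + d) - s r)).
Proof.
move=> p1 r0 rd0 sgd.
pose g a t := (r - a * d) *: p + t *: (d *: p).
have gE a t : g a t = (r + (t - a) * d) *: p.
  by rewrite /g scalerA -scalerDl; congr (_ *: _); ring.
apply: (@joined_smooth _ _ _ 1 g) => //.
- by move=> a; exact: smooth_line.
- by move=> a; rewrite gE subrr mul0r addr0.
- by move=> a; rewrite gE addrAC subrr add0r mul1r.
move=> a.
pose F t := sg * s (r + (t - a) * d).
have arg0 t : a <= t <= a + 1 -> 0 <= r + (t - a) * d by nra.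
have dF t : a <= t <= a + 1 -> is_derive t 1 F (expR (v (r + (t - a) * d)) * `|d|).
  move=> /arg0 t0; have dst := ds t0.
  have dl : is_derive t 1 (fun t => r + (t - a) * d) d.
    rewrite (_ : (fun t => _) = cst (r - a * d) + d *: id); last first.
      by apply/funext => x; rewrite !fctE /GRing.scale/=; ring.
    have := is_deriveD (is_derive_cst (r - a * d) t (1 : R)) (is_deriveZ d (is_derive_id t (1 : R))).
    by rewrite add0r /GRing.scale/= mulr1.
  have dc := @is_derive1_comp _ s (fun t => r + (t - a) * d) t _ _ dst dl.
  apply: is_derive_eq (is_deriveZ sg dc) _.
  by rewrite /GRing.scale/= mulrCA sgd.
have -> : (conf_length w a (a + 1) (g a) =
    \int[mu]_(t in `[a, (a + 1)%R]) (expR (v (r + (t - a) * d)) * `|d|)%:E)%E.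
  apply: eq_integral => t; rewrite inE/= in_itv/= => /arg0 t0.
  by rewrite derive1_line enormZ p1 mulr1 gE wv.
rewrite (@continuous_FTC2 _ _ F).
- rewrite /F subrr mul0r addr0 -EFinB addrAC subrr add0r mul1r -mulrBr.
  by [].
- by rewrite ltrDl.
- apply: continuous_subspaceT => t; apply: cvgM; last exact: cvg_cst.
  apply: (continuous_comp (g := expR)); last exact: continuous_expR.
  apply: (continuous_comp (f := fun t => r + (t - a) * d)); last exact: cv.
  apply: cvgD; first exact: cvg_cst.
  by apply: cvgM; [apply: cvgB; [exact: cvg_id|exact: cvg_cst]|exact: cvg_cst].
- have cF t : a <= t <= a + 1 -> {for t, continuous F}.
    by move=> /dF[dFt _]; apply: differentiable_continuous; apply/derivable1_diffP.
  split.
  + move=> t; rewrite in_itv/= => /andP[/ltW at_ /ltW ta].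
    have tI : a <= t <= a + 1 by rewrite at_ ta.
    by have [] := dF t tI.
  + by apply: cvg_at_right_filter; apply: cF; rewrite lexx lerDl ?ler01 ?andbT.
  + by apply: cvg_at_left_filter; apply: cF; rewrite lexx lerDl ?ler01 ?andbT.
- move=> t; rewrite in_itv/= => /andP[/ltW at_ /ltW ta].
  have tI : a <= t <= a + 1 by rewrite at_ ta.
  by rewrite derive1E; have [_ ->] := dF t tI.
Qed.

Lemma sqr_enormD_ortho (p q : 'rV[R]_n) (a b : R) : enorm p = 1 -> enorm q = 1 ->
  \sum_(i < n) p 0 i * q 0 i = 0 -> enorm (a *: p + b *: q) ^+ 2 = a ^+ 2 + b ^+ 2.
Proof.
move=> p1 q1 pq; rewrite sqr_enorm.
transitivity (a ^+ 2 * enorm p ^+ 2 + b ^+ 2 * enorm q ^+ 2 +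
  2 * a * b * \sum_(i < n) p 0 i * q 0 i).
  rewrite !sqr_enorm !mulr_sumr -!big_split; apply: eq_bigr => i _ /=.
  by rewrite !mxE; ring.
by rewrite pq p1 q1 !expr1n !mulr1 mulr0 addr0.
Qed.

Lemma joined_arc (p q : 'rV[R]_n) (r th : R) : enorm p = 1 -> enorm q = 1 ->
  \sum_(i < n) p 0 i * q 0 i = 0 -> 0 <= r -> 0 <= th ->
  joined w (r *: p) (r *: (cos th *: p + sin th *: q)) (th * (r * expR (v r))).
Proof.
move=> p1 q1 pq r0 th0.
have unit t : enorm (cos t *: p + sin t *: q) = 1.
  apply/eqP; rewrite -(@eqrXn2 _ 2) ?enorm_ge0// sqr_enormD_ortho//.
  by rewrite cos2Dsin2 expr1n.
pose g a t := cos (t + - a) *: (r *: p) + sin (t + - a) *: (r *: q).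
have gE a t : g a t = r *: (cos (t - a) *: p + sin (t - a) *: q).
  by rewrite /g scalerDr !scalerA !(mulrC r).
apply: (@joined_smooth _ _ _ th g) => //.
- by move=> a; exact: smooth_arc.
- by move=> a; rewrite gE subrr cos0 sin0 scale1r scale0r addr0.
- by move=> a; rewrite gE addrAC subrr add0r.
move=> a.
have dg t : enorm (derive1 (g a) t) = r.
  have da : is_derive t 1 (fun t => t - a) 1.
    by rewrite -[X in is_derive _ _ _ X]addr0; apply: is_deriveD.
  have dcos := @is_derive1_comp _ cos (fun t => t - a) t _ _ (is_derive_cos (t - a)) da.
  have dsin := @is_derive1_comp _ sin (fun t => t - a) t _ _ (is_derive_sin (t - a)) da.
  have D : is_derive t 1 (g a) ((1 * (- sin (t - a) * 1)) *: (r *: p) +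
      (1 * (cos (t - a) * 1)) *: (r *: q)).
    by apply: is_deriveD; [exact: (is_derive_scale_vec 1 _ dcos)|exact: (is_derive_scale_vec 1 _ dsin)].
  rewrite derive1E (@derive_val _ _ _ _ _ _ _ D) !mul1r !mulr1.
  rewrite !scalerA !(mulrC _ r) -!scalerA -scalerDr.
  rewrite enormZ ger0_norm//.
  apply/eqP; rewrite -(@eqrXn2 _ 2) ?mulr_ge0 ?enorm_ge0// exprMn sqr_enormD_ortho//.
  by rewrite sqrrN addrC cos2Dsin2 mulr1.
have -> : (conf_length w a (a + th) (g a) =
    \int[mu]_(t in `[a, (a + th)%R]) (cst (expR (v r) * r)%:E) t)%E.
  by apply: eq_integral => t _; rewrite dg gE wv.
have mE := lebesgue_measure_itv `[a, (a + th)%R].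
rewrite /= lte_fin ltrDl in mE.
have {}mE : lebesgue_measure `[a, (a + th)%R]%classic = th%:E.
  rewrite mE; case: ltgtP th0 => // [_|<-] _//.
  by rewrite -EFinB addrAC subrr add0r.
have := @integral_cst _ _ _ mu _ (measurable_itv `[a, (a + th)%R]) (expR (v r) * r)%:E.
move=> ->; rewrite [X in (_ * X)%E](_ : _ = th%:E); last exact: mE.
rewrite -EFinM lee_fin.
by rewrite mulrC (mulrC r).
Qed.
End pieces.

(** * Unit vectors and great circles *)

Section great_circles.
Variables (R : realType) (n : nat).
Implicit Types p q x : 'rV[R]_n.

Definition dot p q : R := \sum_(i < n) p 0 i * q 0 i.

Lemma dotDr p q x : dot p (q + x) = dot p q + dot p x.
Proof. by rewrite /dot -big_split; apply: eq_bigr => i _; rewrite mxE mulrDr. Qed.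

Lemma dotZr p (a : R) q : dot p (a *: q) = a * dot p q.
Proof. by rewrite /dot mulr_sumr; apply: eq_bigr => i _; rewrite mxE mulrCA. Qed.

Lemma dotC p q : dot p q = dot q p.
Proof. by apply: eq_bigr => i _; rewrite mulrC. Qed.

Lemma dotxx p : dot p p = enorm p ^+ 2.
Proof. by rewrite sqr_enorm; apply: eq_bigr => i _; rewrite expr2. Qed.

Lemma dot_delta p i : dot p (delta_mx 0 i) = p 0 i.
Proof.
rewrite /dot (bigD1 i)//= mxE !eqxx mulr1 big1 ?addr0// => k ki.
by rewrite mxE (negbTE ki) andbF mulr0.
Qed.

Lemma enorm_delta (i : 'I_n) : enorm (delta_mx 0 i : 'rV[R]_n) = 1.
Proof.
apply/eqP; rewrite -(@eqrXn2 _ 2) ?enorm_ge0// -dotxx dot_delta mxE !eqxx.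
by rewrite expr1n.
Qed.

Lemma enorm_eq0 p : enorm p = 0 -> p = 0.
Proof.
move=> p0; apply/rowP => i; rewrite mxE.
have : \sum_(i < n) p 0 i ^+ 2 == 0 by rewrite -sqr_enorm p0 expr0n.
rewrite psumr_eq0; last by move=> j _; exact: sqr_ge0.
by move=> /allP/(_ i); rewrite mem_index_enum sqrf_eq0 => /(_ isT)/eqP.
Qed.

Lemma enorm_normalize p : enorm p != 0 -> enorm ((enorm p)^-1 *: p) = 1.
Proof. by move=> p0; rewrite enormZ ger0_norm ?invr_ge0 ?enorm_ge0// mulVf. Qed.

Lemma polar_decomposition (i0 : 'I_n) x :
  exists r p, [/\ 0 <= r, enorm p = 1 & x = r *: p].
Proof.
have [x0|x0] := eqVneq (enorm x) 0.
  exists 0, (delta_mx 0 i0); rewrite enorm_delta; split => //.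
  by rewrite scale0r; exact: enorm_eq0.
exists (enorm x), ((enorm x)^-1 *: x); split; [exact: enorm_ge0|exact: enorm_normalize|].
by rewrite scalerA divff// scale1r.
Qed.

(** Rotate the first two coordinates of [p] by a quarter turn; if both of them
    vanish, the first basis vector is orthogonal to [p]. *)
Lemma unit_orthogonal p : (2 <= n)%N -> exists b, enorm b = 1 /\ dot p b = 0.
Proof.
move=> n2; pose i0 := Ordinal (ltnW n2); pose i1 := Ordinal n2.
pose b : 'rV[R]_n := - p 0 i1 *: delta_mx 0 i0 + p 0 i0 *: delta_mx 0 i1.
have pb : dot p b = 0.
  by rewrite dotDr !dotZr !dot_delta mulNr mulrC addNr.
have [b0|b0] := eqVneq (enorm b) 0; last first.
  by exists ((enorm b)^-1 *: b); rewrite enorm_normalize// dotZr pb mulr0.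
exists (delta_mx 0 i0); rewrite enorm_delta dot_delta; split => //.
by have /rowP/(_ i1) := enorm_eq0 b0; rewrite !mxE/= mulr0 add0r mulr1.
Qed.

(** [q] splits into [cos th *: p] and a vector [y] orthogonal to [p] of norm
    [sin th].  When [y = 0], that is for equal or antipodal points, any
    orthogonal direction will do. *)
Lemma great_circle p q : (2 <= n)%N -> enorm p = 1 -> enorm q = 1 ->
  exists th b, [/\ 0 <= th <= pi, enorm b = 1, dot p b = 0 &
    q = cos th *: p + sin th *: b].
Proof.
move=> n2 p1 q1; pose c := dot p q.
pose y := q + (- c) *: p.
have py : dot p y = 0 by rewrite dotDr dotZr dotxx p1 expr1n mulr1 subrr.
have y2 : enorm y ^+ 2 = 1 - c ^+ 2.
  rewrite -dotxx {2}/y dotDr dotZr (dotC y p) py mulr0 addr0 dotC dotDr dotZr dotxx.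
  by rewrite q1 (dotC q p) -/c expr1n expr2 mulNr.
have c1 : -1 <= c <= 1.
  have : 0 <= 1 - c ^+ 2 by rewrite -y2 sqr_ge0.
  by move=> ?; apply/andP; split; nra.
have cK : cos (acos c) = c by apply: acosK; rewrite in_itv.
have th0 : 0 <= acos c <= pi by rewrite acos_ge0 ?acos_lepi.
have sy : sin (acos c) = enorm y.
  by rewrite sin_acos// -y2 sqrtr_sqr ger0_norm// enorm_ge0.
have qE : q = c *: p + y by rewrite /y addrCA -scalerDl subrr scale0r addr0.
have [y0|y0] := eqVneq (enorm y) 0.
  have [b [b1 pb]] := unit_orthogonal p n2.
  exists (acos c), b; split => //.
  by rewrite sy y0 scale0r cK qE (enorm_eq0 y0).
exists (acos c), ((enorm y)^-1 *: y); split => //.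
- exact: enorm_normalize.
- by rewrite dotZr py mulr0.
- by rewrite sy cK scalerA divff// scale1r.
Qed.
End great_circles.

(** * Volume of the sphere in the stereographic chart *)

Section stereo.
Variables (R : realType) (n : nat).
Implicit Types x v : 'rV[R]_n.

Let Q x : R := 1 + \sum_(i < n) x 0 i ^+ 2.

Let Q_gt0 x : 0 < Q x.
Proof. by rewrite ltr_wpDr// sumr_ge0// => i _; exact: sqr_ge0. Qed.

Let diffQ x : differentiable Q x.
Proof.
rewrite (_ : Q = cst 1 + \sum_(i < n) (fun x => x 0 i : R) ^+ 2).
  apply: differentiableD => //; apply: differentiable_sum => i.
  by apply: differentiableX; exact: differentiable_coord.
by apply/funext => y; rewrite /Q !fctE fct_sumE.
Qed.

Let is_derive_coord x v i : is_derive x v (fun x => x 0 i : R) (v 0 i).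
Proof.
have d : derivable (id : 'rV[R]_n -> 'rV[R]_n) x v by [].
apply: DeriveDef; first exact: (derivable_mxP _ _ _).1.
by have := derive_mx d; rewrite derive_id => /matrixP/(_ 0 i); rewrite mxE.
Qed.

Let is_derive_Q x v : is_derive x v Q (2 * \sum_(i < n) x 0 i * v 0 i).
Proof.
rewrite (_ : Q = cst 1 + \sum_(i < n) (fun x => x 0 i : R) ^+ 2); last first.
  by apply/funext => y; rewrite /Q !fctE fct_sumE.
have dX i := is_deriveX 2 (is_derive_coord x v i).
apply: is_derive_eq (is_deriveD (is_derive_cst (1 : R) x v) (is_derive_sum dX)) _.
rewrite add0r mulr_sumr; apply: eq_bigr => i _.
by rewrite expr1 mulrA.
Qed.

Let is_derive_invQ x v : is_derive x v (fun x => 2 / Q x)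
  (- (4 / Q x ^+ 2 * \sum_(i < n) x 0 i * v 0 i)).
Proof.
have Q0 := lt0r_neq0 (Q_gt0 x).
have dQ : is_derive x v (fun x => (Q x)^-1) (- (Q x) ^- 2 *: (2 * \sum_(i < n) x 0 i * v 0 i)).
  have [dQ <-] := is_derive_Q x v.
  by apply: DeriveDef; [exact: derivableV|exact: deriveV].
apply: is_derive_eq (is_deriveZ 2 dQ) _.
by rewrite /GRing.scale/=; field.
Qed.

Let phil x (k : 'I_n) : inv_stereo x 0 (lshift 1 k) = (2 / Q x) * x 0 k.
Proof. by rewrite /inv_stereo row_mxEl mxE sqr_enorm. Qed.

(* In this form the last coordinate has the same derivative as [2 / Q], up to
   sign. *)
Let phir x (k : 'I_1) : inv_stereo x 0 (rshift n k) = 1 - 2 / Q x.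
Proof.
rewrite /inv_stereo row_mxEr mxE ord1 eqxx mulr1n sqr_enorm.
have := lt0r_neq0 (Q_gt0 x); rewrite /Q => Q0; field.
exact: Q0.
Qed.

Let diff_stereo x : differentiable (@inv_stereo R n) x.
Proof.
rewrite (_ : @inv_stereo R n = \sum_(j < n + 1) (fun x => inv_stereo x 0 j *: delta_mx 0 j)).
  have dQ y : differentiable (fun x => 2 / Q x) y.
    apply: differentiableM => //.
    by apply: differentiableV => //; exact: lt0r_neq0.
  apply: differentiable_sum => j; apply: differentiableZl.
  case: (split_ordP j) => k ->.
    under eq_fun do rewrite phil.
    by apply: differentiableM => //; exact: differentiable_coord.
  under eq_fun do rewrite phir.
  exact: differentiableB.
by apply/funext => y; rewrite fct_sumE [LHS]row_sum_delta.
Qed.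

(** The inverse stereographic projection is conformal, with factor [2 / Q]. *)
Lemma jacobian_inv_stereo x :
  jacobian (@inv_stereo R n) x *m (jacobian (@inv_stereo R n) x)^T =
  ((2 / Q x) ^+ 2)%:M.
Proof.
have JE i j : jacobian (@inv_stereo R n) x i j =
    'D_(delta_mx 0 i) (fun y => inv_stereo y 0 j) x.
  have := deriveEjacobian (delta_mx 0 i) (diff_stereo x).
  rewrite derive_mx; last exact: diff_derivable.
  by rewrite -rowE => /matrixP/(_ 0 j); rewrite !mxE.
have sE i : \sum_(k < n) x 0 k * (delta_mx 0 i : 'rV[R]_n) 0 k = x 0 i.
  rewrite (bigD1 i)//= mxE !eqxx mulr1 big1 ?addr0// => k ki.
  by rewrite mxE (negbTE ki) mulr0.
have Jl i k : jacobian (@inv_stereo R n) x i (lshift 1 k) =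
    2 / Q x * (i == k)%:R - 4 / Q x ^+ 2 * x 0 i * x 0 k.
  rewrite JE; under eq_fun do rewrite phil.
  have := is_deriveM (is_derive_invQ x (delta_mx 0 i)) (is_derive_coord x (delta_mx 0 i) k).
  move=> /@derive_val ->; rewrite sE mxE eqxx/= /GRing.scale/= eq_sym.
  by ring.
have Jr i k : jacobian (@inv_stereo R n) x i (rshift n k) =
    4 / Q x ^+ 2 * x 0 i.
  rewrite JE; under eq_fun do rewrite phir.
  have := is_deriveB (is_derive_cst (1 : R) x (delta_mx 0 i)) (is_derive_invQ x (delta_mx 0 i)).
  move=> /@derive_val ->; rewrite sE.
  by ring.
apply/matrixP => i j; rewrite mxE [RHS]mxE.
under eq_bigr do rewrite [X in _ * X]mxE.
rewrite big_split_ord big_ord1 !Jr/=.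
under [X in X + _]eq_bigr do rewrite !Jl.
set q := Q x; set S := \sum_(k < n) x 0 k ^+ 2.
have q0 : q != 0 by exact: lt0r_neq0 (Q_gt0 x).
have dE (c : 'I_n -> R) (l : 'I_n) : \sum_(k < n) (l == k)%:R * c k = c l.
  rewrite (bigD1 l)//= eqxx mul1r big1 ?addr0// => k.
  by rewrite eq_sym => /negbTE ->; rewrite mul0r.
rewrite (_ : \sum_(k < n) _ = (2 / q) ^+ 2 * (i == j)%:R
   - 16 / q ^+ 3 * (x 0 i * x 0 j) + 16 / q ^+ 4 * (x 0 i * x 0 j) * S); last first.
  transitivity (\sum_(k < n) ((i == k)%:R * ((2 / q) ^+ 2 * (j == k)%:R)
     - (i == k)%:R * (8 / q ^+ 3 * (x 0 j * x 0 k))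
     - (j == k)%:R * (8 / q ^+ 3 * (x 0 i * x 0 k))
     + 16 / q ^+ 4 * (x 0 i * x 0 j) * x 0 k ^+ 2)).
    by apply: eq_bigr => k _; field.
  rewrite big_split/= -mulr_sumr sumrB sumrB !dE eq_sym -/S.
  by field.
have SE : S = q - 1 by rewrite /q /Q -/S; ring.
by rewrite SE mulr_natr; field; exact: q0.
Qed.

Lemma sphere_volumeE : (sphere_volume R n =
  \int[lebesgue_tuple R n]_t ((2 / (1 + tnorm t ^+ 2)) ^+ n)%:E)%E.
Proof.
apply: eq_integral => t _; congr EFin.
rewrite jacobian_inv_stereo det_scalar -exprM mulnC exprM sqrtr_sqr ger0_norm.
  by rewrite /tnorm sqr_enorm.
by rewrite exprn_ge0// divr_ge0// ltW.
Qed.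
End stereo.

(** * Diameter and volume of the conformal metric *)

(** Both derivatives are limits of the same difference quotient. *)
Lemma is_derive_along (R : realType) (V : normedModType R) (f : V -> R) (e : V) (x : R) :
  derivable f (x *: e) e ->
  is_derive x 1 (fun t => f (t *: e)) ('D_e f (x *: e)).
Proof.
move=> df.
have E : (fun h : R => h^-1 *: (f (h *: e + x *: e) - f (x *: e))) =
    (fun h => h^-1 *: (f ((h *: 1 + x) *: e) - f (x *: e))).
  by apply/funext => h; rewrite -scalerDl /GRing.scale/= mulr1.
by apply: DeriveDef; [move: df; rewrite /derivable|rewrite /derive]; rewrite /= E.
Qed.

Section radial_metric.
Variables (R : realType) (n : nat) (u : R -> R).
Hypothesis n2 : (2 <= n)%N.
Let w (x : 'rV[R]_n) := u (enorm x).
Hypothesis smooth_w : smooth w.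
Hypothesis ric : forall r : R, 0 < r ->
  derive1n 2 u r + derive1 u r / r + expR (2 * u r) <= 0.

Let i0 : 'I_n := Ordinal (ltnW n2).
Let e : 'rV[R]_n := delta_mx 0 i0.

(* The restriction of the conformal exponent to a line through the origin is
   smooth on all of [R], unlike [u], whose values at negative numbers are
   arbitrary. *)
Let v (x : R) := w (x *: e).
Let v1 (x : R) := 'D_e w (x *: e).
Let v2 (x : R) := 'D_e ('D_e w) (x *: e).

Let vE x : v x = u `|x|.
Proof. by rewrite /v /w enormZ enorm_delta mulr1. Qed.

Let cw : continuous w. Proof. exact: (smooth_w 0%N). Qed.

Let dv (x : R) : is_derive x 1 v (v1 x).
Proof.
have [_ /(_ e)[dw _]] := smooth_w 1%N.
by apply: (is_derive_along (f := w)); exact: dw.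
Qed.

Let dv1 (x : R) : is_derive x 1 v1 (v2 x).
Proof.
have [_ /(_ e)[_ [_ /(_ e)[dw _]]]] := smooth_w 2%N.
by apply: (is_derive_along (f := 'D_e w)); exact: dw.
Qed.

Let cv : continuous v.
Proof.
by move=> x; apply: differentiable_continuous; apply/derivable1_diffP; have [] := dv x.
Qed.

Let wv (r : R) (p : 'rV[R]_n) : 0 <= r -> enorm p = 1 -> w (r *: p) = v r.
Proof. by move=> r0 p1; rewrite vE /w enormZ p1 mulr1. Qed.

Let ricv (r : R) : 0 < r -> v2 r + v1 r / r + expR (2 * v r) <= 0.
Proof.
have d1 (x : R) : 0 < x -> derive1 u x = v1 x.
  move=> x0; have [_ <-] := dv x; rewrite derive1E; apply: near_eq_derive.
  by near=> y; rewrite vE gtr0_norm//; near: y; exact: lt_nbhsr.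
move=> r0.
have d2 : derive1n 2 u r = v2 r.
  have [_ <-] := dv1 r; rewrite derive1nS derive1n1 derive1E; apply: near_eq_derive.
  by near=> y; apply: d1; near: y; exact: lt_nbhsr.
by have := ric r0; rewrite d2 (d1 r r0) (vE r) (gtr0_norm r0).
Unshelve. all: by end_near. Qed.

Let cU : continuous (expR \o v).
Proof. by move=> x; apply: continuous_comp; [exact: cv|exact: continuous_expR]. Qed.

(** The two routes, through the origin and along a far away circle, have lengths
    of mean at most [pi], up to the length of the arc. *)
Lemma conf_diam_le_pi : (conf_diam w <= pi%:E)%E.
Proof.
have [s [s0 ds]] := primitive_exists cU.
have radius_lt_pi := geodesic_radius_lt_pi dv dv1 ricv s0 ds.
apply: ge_ereal_sup => _ [x [y ->]].
have [r1 [p [r10 p1 ->]]] := polar_decomposition i0 x.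
have [r2 [q [r20 q1 ->]]] := polar_decomposition i0 y.
have outward r r' z : 0 <= r -> r <= r' -> enorm z = 1 ->
    joined w (r *: z) (r' *: z) (s r' - s r).
  move=> r0 rr' z1; rewrite -[s r' - _]mul1r -[r'](subrKC r).
  apply: joined_radial => //; first by rewrite subrKC (le_trans r0).
  by rewrite mul1r ger0_norm// subr_ge0.
have inward r r' z : 0 <= r -> r <= r' -> enorm z = 1 ->
    joined w (r' *: z) (r *: z) (s r' - s r).
  move=> r0 rr' z1; rewrite -[s r' - _]opprB -[- (_ - _)]mulN1r -[r](subrKC r').
  apply: joined_radial => //; [exact: le_trans rr'|by rewrite subrKC|].
  by rewrite mulN1r ler0_norm// subr_le0.
have [short|long] := leP (s r1 + s r2) pi.
  apply: conf_dist_le; apply: joined_le short.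
  apply: (joined_trans (y := 0)).
    by have := inward 0 r1 p (lexx 0) r10 p1; rewrite s0 subr0 scale0r.
  by have := outward 0 r2 q (lexx 0) r20 q1; rewrite s0 subr0 scale0r.
apply/lee_addgt0Pr => eps eps0.
have pi0 := pi_gt0 R.
have [r [rbig r0 rs]] := warp_small dv dv1 ricv s0 ds (Num.max r1 r2) (divr_gt0 eps0 pi0).
have [rr1 rr2] : r1 <= r /\ r2 <= r by move: rbig; rewrite ge_max => /andP.
have [th [b [/andP[th0 thpi] b1 pb qE]]] := great_circle n2 p1 q1.
have arc : joined w (r *: p) (r *: q) (th * (r * expR (v r))).
  by rewrite qE; apply: joined_arc => //; exact: ltW.
rewrite -EFinD; apply: conf_dist_le.
apply: joined_le (joined_trans (joined_trans (outward _ _ _ r10 rr1 p1) arc)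
  (inward _ _ _ r20 rr2 q1)) _.
have arc_le : th * (r * expR (v r)) <= eps.
  rewrite -[eps](divfK (lt0r_neq0 pi0)) mulrC.
  by apply: ler_pM => //; rewrite mulr_ge0 ?expR_ge0// ltW.
have := radius_lt_pi r (ltW r0); lra.
Qed.

(** The comparison map sends a point to the one in the same direction, at the
    same distance from the pole, on the round sphere, read in the stereographic
    chart. *)
Lemma conf_volume_le_sphere : (conf_volume w <= sphere_volume R n)%E.
Proof.
have [s [s0 ds]] := primitive_exists cU.
have [om om0 omE] := tball_measure R n.
rewrite sphere_volumeE.
pose F x := expR (v x) ^+ n.
pose G (x : R) := (2 / (1 + x ^+ 2)) ^+ n.
rewrite (_ : conf_volume w = \int[lebesgue_tuple R n]_t (F (tnorm t))%:E)%E; last first.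
  apply: eq_integral => t _; rewrite /F vE ger0_norm ?tnorm_ge0//.
  by rewrite -expRM_natl.
have n0 : (0 < n)%N := ltnW n2.
have cF : continuous F.
  move=> x; apply: (continuous_comp (f := expR \o v) (g := fun y => y ^+ n)); first exact: cU.
  exact: exprn_continuous.
have q0 (x : R) : 0 < 1 + x ^+ 2 by rewrite ltr_wpDr// sqr_ge0.
have cG : continuous G.
  move=> x; apply: (continuous_comp (f := fun x : R => 2 / (1 + x ^+ 2)) (g := fun y => y ^+ n)).
    apply: cvgM; first exact: cvg_cst.
    apply: cvgV; first exact: lt0r_neq0.
    by apply: cvgD; [exact: cvg_cst|exact: exprn_continuous].
  exact: exprn_continuous.
apply: (radial_integral_comparison (F := F) (G := G) (rho := half_tan s)
  (drho := fun r => (1 + half_tan s r ^+ 2) / 2 * expR (v r)) om0 omE n0 cF cG).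
- by move=> x; rewrite exprn_ge0// expR_ge0.
- by move=> x; rewrite exprn_ge0// divr_ge0// ltW.
- by move=> r r0; exact: (is_derive_half_tan dv dv1 ricv s0 ds).
- by move=> r r0; exact: (half_tan_gt0 dv dv1 ricv s0 ds).
- move=> r r0; rewrite /F /G -(prednK n0).
  exact: (radial_transplant dv dv1 ricv s0 ds).
Qed.
End radial_metric.

Theorem proposition6p2 (R : realType) (n : nat) (u : R -> R) :
  (2 <= n)%N ->
  smooth (fun x : 'rV[R]_n => u (enorm x)) ->
  (forall r : R, 0 < r ->
     derive1n 2 u r + derive1 u r / r + expR (2 * u r) <= 0) ->
  (forall r : R, 0 < r ->
     derive1n 2 u r + (2 * n%:R - 3) * (derive1 u r / r)
       + (n%:R - 2) * derive1 u r ^+ 2 + (n%:R - 1) * expR (2 * u r) <= 0) ->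
  (conf_diam (fun x : 'rV[R]_n => u (enorm x)) <= pi%:E)%E /\
  (conf_volume (fun x : 'rV[R]_n => u (enorm x)) <= sphere_volume R n)%E.
Proof.
move=> n2 sw ric _; split.
- exact: conf_diam_le_pi.
- exact: conf_volume_le_sphere.
Qed.
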